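(* Let $(\mathcal{X},\mathcal{F},\sigma)$ be a sigma-finite measure space with an atomic filtration $(\mathcal{F}_n)_{n\in\mathbb{Z}}$ and let $\mathcal{D}$ be its collection of atoms. Let $\mathbf{W}$ be a $d\times d$ matrix-valued measure on $\mathcal{X}$ and let $\widetilde A_I$, $I\in\mathcal{D}$, be positive semidefinite $d\times d$ matrices. The following statements are equivalent: (i) there is a finite constant $A$ such that $$\sum_{I\in\mathcal{D}}\Bigl\|\widetilde A_I^{1/2}\int_I \mathbf{W}(dx)f(x)\Bigr\|^2\le A\,\|f\|_{L^2(\mathbf{W})}^2\qquad\text{for all } f\in L^2(\mathbf{W});$$ (ii) there is a finite constant $B$ such that $$\sum_{I\in\mathcal{D},\ I\subset I_0}\mathbf{W}(I)\,\widetilde A_I\,\mathbf{W}(I)\le B\,\mathbf{W}(I_0)\qquad\text{for all } I_0\in\mathcal{D}.$$ Moreover, the best (smallest) constants $A$ in (i) and $B$ in (ii) satisfy $B\le A\le C B$, where $C=C(d)=4e^2d^2$.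
   Context: Fix $\mathbb{F}=\mathbb{R}$ or $\mathbb{C}$; matrices have entries in $\mathbb{F}$, vectors lie in $\mathbb{F}^d$ with its standard inner product $\langle\cdot,\cdot\rangle$ and norm $\|\cdot\|$. Positive semidefinite matrices are self-adjoint, and inequalities between matrices are in the sense of positive semidefinite (Loewner) order. Atomic filtration: $(\mathcal{F}_n)_{n\in\mathbb{Z}}$ is an increasing sequence of sigma-algebras $\mathcal{F}_n\subset\mathcal{F}$ such that for each $n$ there is a countable collection $\mathcal{D}_n\subset\mathcal{F}_n$ of disjoint sets of finite $\sigma$-measure such that every set of $\mathcal{F}_n$ is a union of sets in $\mathcal{D}_n$. The elements of $\mathcal{D}_n$ are called atoms, and $\mathcal{D}=\bigcup_{n\in\mathbb{Z}}\mathcal{D}_n$ is the collection of all atoms. A set may belong to several $\mathcal{D}_n$; formally an atom is a pair $(I,n)$ with $I\in\mathcal{D}_n$, written simply $I$, with $\operatorname{rk} I:=n$, and sums and families indexed by $\mathcal{D}$ are indexed by such pairs. For atoms, $I\subset J$ means set inclusion together with $\operatorname{rk} I\ge\operatorname{rk} J$. Matrix-valued measure: let $\mathcal{F}_0$ be the collection of sets $E\cap F$ where $E\in\mathcal{F}$ and $F$ is a finite union of atoms. A $d\times d$ matrix-valued measure $\mathbf{W}$ on $\mathcal{X}$ is a countably additive function on $\mathcal{F}_0$ with values in the set of $d\times d$ positive semidefinite matrices. Equivalently, $\mathbf{W}=(\mathbf{w}_{j,k})_{j,k=1}^d$ where the entries are (possibly signed or complex-valued) measures, finite on atoms, such that $(\mathbf{w}_{j,k}(E))_{j,k}$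 is positive semidefinite for every $E\in\mathcal{F}_0$. No absolute continuity with respect to $\sigma$ is assumed. $L^2(\mathbf{W})$ is the set of all measurable $\mathbb{F}^d$-valued functions $f$ with $\|f\|_{L^2(\mathbf{W})}^2:=\int_{\mathcal{X}}\langle \mathbf{W}(dx)f(x),f(x)\rangle<\infty$ (modulo functions of norm $0$). Integrals against $\mathbf{W}$ can be understood by writing $\mathbf{W}=W\,d\mu$ with $\mu=\operatorname{tr}\mathbf{W}=\sum_k\mathbf{w}_{k,k}$ and $W$ the matrix-valued density: $\int_I\mathbf{W}(dx)f(x)=\int_I W f\,d\mu$ and $\int\langle\mathbf{W}(dx)f,f\rangle=\int\langle Wf,f\rangle\,d\mu$. *)

(* Defs.v *)
From HB Require Import structures.
From mathcomp Require Import all_boot all_order all_algebra finmap.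
From mathcomp.analysis.showcase Require Import summability.
From mathcomp Require Import all_classical all_reals all_analysis.
From mathcomp.real_closed Require Import complex.

Set Implicit Arguments.
Unset Strict Implicit.
Unset Printing Implicit Defensive.

Import Order.TTheory GRing.Theory Num.Theory numFieldNormedType.Exports.

Local Open Scope classical_set_scope.
Local Open Scope ring_scope.

Inductive scalar_kind := RealScalars | ComplexScalars.

Definition base_field (R : realType) (k : scalar_kind) : numFieldType :=
  match k with
  | RealScalars => (R : numFieldType)
  | ComplexScalars => (R[i] : numFieldType)
  end.

Section scalars.
Context {R : realType} {k : scalar_kind}.

Definition sre : base_field R k -> R :=
  match k return base_field R k -> R with
  | RealScalars => fun x => x
  | ComplexScalars => fun z : R[i] => complex.Re z
  end.

Definition sim : base_field R k -> R :=
  match k return base_field R k -> R with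
  | RealScalars => fun=> 0
  | ComplexScalars => fun z : R[i] => complex.Im z
  end.

Definition sconj : base_field R k -> base_field R k :=
  match k return base_field R k -> base_field R k with
  | RealScalars => fun x => x
  | ComplexScalars => fun z : R[i] => conjc z
  end.

(* The scalar with real part a and imaginary part b; b is dropped over R. *)
Definition smk : R -> R -> base_field R k :=
  match k return R -> R -> base_field R k with
  | RealScalars => fun a _ => a
  | ComplexScalars => fun a b => Complex a b
  end.

Definition sreal (a : R) : base_field R k := smk a 0.

End scalars.

Section matrices.
Context {R : realType} {k : scalar_kind} {d : nat}.
Local Notation K := (base_field R k).

Definition adjmx {m n} (M : 'M[K]_(m, n)) : 'M[K]_(n, m) := map_mx sconj M^T.

Definition inner (u v : 'cV[K]_d) : K := \sum_i u i 0 * sconj (v i 0).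

Definition vnorm (u : 'cV[K]_d) : R := Num.sqrt (sre (inner u u)).

(* In R[i], 0 <= z means that z is real and nonnegative. *)
Definition psdmx (M : 'M[K]_d) : Prop :=
  adjmx M = M /\ forall u : 'cV[K]_d, 0 <= inner (M *m u) u.

Definition loewner_le (M N : 'M[K]_d) : Prop := psdmx (N - M).

(* The positive semidefinite square root; it exists and is unique when M is
   positive semidefinite, and the default 0 is irrelevant in that case. *)
Definition sqrtmx (M : 'M[K]_d) : 'M[K]_d :=
  xget 0 [set S | psdmx S /\ S *m S = M].

(* Unconditional (net over finite subsets) convergence of the sum of the
   matrices u t, t in D, to S, entry by entry. *)
Definition mxsum_to {T : choiceType} (D : set T) (u : T -> 'M[K]_d)
    (S : 'M[K]_d) : Prop :=
  forall i j,
    (fun J : {fset T} => \sum_(t <- J | t \in D) sre (u t i j)) @ totally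
      --> sre (S i j) /\
    (fun J : {fset T} => \sum_(t <- J | t \in D) sim (u t i j)) @ totally
      --> sim (S i j).

End matrices.

Record atomic_filtration {R : realType} {disp : measure_display}
    {X : measurableType disp} (sigma : set X -> \bar R) := AtomicFiltration {
  filt : int -> set (set X) ;
  rank_atoms : int -> set (set X) ;
  filt_sigma_algebra : forall n, sigma_algebra setT (filt n) ;
  filt_measurable : forall n, filt n `<=` measurable ;
  filt_increasing : forall m n, m <= n -> filt m `<=` filt n ;
  rank_atoms_filt : forall n, rank_atoms n `<=` filt n ;
  rank_atoms_countable : forall n, countable (rank_atoms n) ;
  rank_atoms_disjoint : forall n, trivIset (rank_atoms n) id ;
  rank_atoms_finite : forall n I, rank_atoms n I -> (sigma I < +oo)%E ;
  filt_atomic : forall n E, filt n E ->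
    exists2 S, S `<=` rank_atoms n & E = \bigcup_(I in S) I
}.

Section atoms.
Context {R : realType} {disp : measure_display} {X : measurableType disp}.
Context {sigma : set X -> \bar R} (F : atomic_filtration sigma).

(* An atom is a pair (set, rank). *)
Definition atoms : set (set X * int) := [set I | rank_atoms F I.2 I.1].

Definition atom_sub (I J : set X * int) : Prop :=
  I.1 `<=` J.1 /\ J.2 <= I.2.

(* The sets E `&` G with E measurable and G a finite union of atoms. *)
Definition local_measurable : set (set X) :=
  [set A | exists E (S : set (set X * int)),
    [/\ measurable E, finite_set S, S `<=` atoms &
        A = E `&` \bigcup_(I in S) I.1]].

End atoms.

(* The values of a matrix measure outside local_measurable are meaningless. *)
Record matrix_measure {R : realType} (k : scalar_kind) {disp : measure_display}
    {X : measurableType disp} {sigma : set X -> \bar R}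
    (F : atomic_filtration sigma) (d : nat) := MatrixMeasure {
  mxm_val :> set X -> 'M[base_field R k]_d ;
  mxm_psd : forall E, local_measurable F E -> psdmx (mxm_val E) ;
  mxm_sigma_additive : forall E : (set X)^nat,
    (forall n, local_measurable F (E n)) -> trivIset setT E ->
    local_measurable F (\bigcup_n E n) ->
    forall i j,
      (\sum_(0 <= m < n) sre (mxm_val (E m) i j)) @[n --> \oo]
        --> sre (mxm_val (\bigcup_n E n) i j) /\
      (\sum_(0 <= m < n) sim (mxm_val (E m) i j)) @[n --> \oo]
        --> sim (mxm_val (\bigcup_n E n) i j)
}.

Section matrix_measure_integration.
Context {R : realType} {k : scalar_kind} {disp : measure_display}
  {X : measurableType disp} {sigma : set X -> \bar R}
  {F : atomic_filtration sigma} {d : nat}.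
Local Notation K := (base_field R k).

Definition scalar_measurable (g : X -> K) : Prop :=
  measurable_fun setT (sre \o g) /\ measurable_fun setT (sim \o g).

Definition scalar_integrable (mu : set X -> \bar R) (E : set X) (g : X -> K) : Prop :=
  mu.-integrable E (fun x => (sre (g x))%:E) /\
  mu.-integrable E (fun x => (sim (g x))%:E).

Definition scalar_integral (mu : set X -> \bar R) (E : set X) (g : X -> K) : K :=
  smk (fine (\int[mu]_(x in E) (sre (g x))%:E))
      (fine (\int[mu]_(x in E) (sim (g x))%:E)).

Variable W : matrix_measure k F d.

(* tr W, extended from local_measurable to all measurable sets. *)
Definition trace_measure (E : set X) : \bar R :=
  ereal_sup [set (sre (\tr (W G)))%:E |
             G in [set G | local_measurable F G /\ G `<=` E]].

Definition is_density (V : X -> 'M[K]_d) : Prop :=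
  forall i j,
    scalar_measurable (fun x => V x i j) /\
    forall E, local_measurable F E ->
      scalar_integrable trace_measure E (fun x => V x i j) /\
      W E i j = scalar_integral trace_measure E (fun x => V x i j).

(* The density of W with respect to trace_measure W, unique up to a null set;
   it exists by the Radon-Nikodym theorem, so the default is never used. *)
Definition density : X -> 'M[K]_d := xget (fun=> 0) [set V | is_density V].

Definition sqnorm_L2 (f : X -> 'cV[K]_d) : \bar R :=
  \int[trace_measure]_x (sre (inner (density x *m f x) (f x)))%:E.

Definition in_L2 (f : X -> 'cV[K]_d) : Prop :=
  (forall i, scalar_measurable (fun x => f x i 0)) /\ (sqnorm_L2 f < +oo)%E.

Definition mxm_integral (E : set X) (f : X -> 'cV[K]_d) : 'cV[K]_d :=
  \col_i scalar_integral trace_measure E (fun x => (density x *m f x) i 0).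

Definition carleson_embedding (A : set X * int -> 'M[K]_d) (a : R) : Prop :=
  forall f, in_L2 f ->
    (\esum_(I in atoms F)
       (vnorm (sqrtmx (A I) *m mxm_integral I.1 f) ^+ 2)%:E
     <= a%:E * sqnorm_L2 f)%E.

Definition carleson_testing (A : set X * int -> 'M[K]_d) (b : R) : Prop :=
  forall I0, atoms F I0 ->
    exists2 S : 'M[K]_d,
      mxsum_to [set I | atoms F I /\ atom_sub I I0]
        (fun I => W I.1 *m A I *m W I.1) S &
      loewner_le S (sreal b *: W I0.1).

End matrix_measure_integration.

(* Nonnegativity matters only in degenerate cases (such as W = 0), where every
   real constant is admissible. *)
Definition best_constant {R : realType} (P : R -> Prop) (c : R) : Prop :=
  [/\ 0 <= c, P c & forall c', 0 <= c' -> P c' -> c <= c'].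

(* Main.v *)
Require Import Defs.
From HB Require Import structures.
From mathcomp Require Import all_boot all_order all_algebra finmap.
From mathcomp.analysis.showcase Require Import summability.
From mathcomp Require Import all_classical all_reals all_analysis.
From mathcomp Require Import measurable_realfun.
From mathcomp.real_closed Require Import complex.
From mathcomp Require Import ring lra zify.

(** For (i) => (ii), test (i) on f = 1_{I_0} v.

    For (ii) => (i), it suffices to bound finite sums. Let F_I be the integral of
    W f over I, M_I the sum of W(J) A_J W(J) over the finitely many J in I, and let
    v_I(s) solve (W(I) + s M_I) v_I(s) = F_I. The forms
    2 <F_I, u> - <(W(I) + s M_I) u, u> are maximal at u = v_I(s), so that an
    induction on the tree of atoms gives, for each s > 0,
      s * sum_I <A_I W(I) v_I(s), W(I) v_I(s)> <= ||f||^2.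
    Assume M_I <= W(I). With W = W(I), M_I = W^(1/2) T W^(1/2) and
    F_I = W^(1/2) h, the vector W(I) v_I(s) equals W^(1/2) (1 + s T)^(-1) h, which
    becomes a polynomial of degree < d in s after multiplication by
    det (1 + s T) <= (1 + s)^d. In the variable x = (1 - s) / (1 + s), Lagrange
    interpolation at the Chebyshev nodes recovers its value F_I at s = 0 (x = 1);
    as in the proof of Bernstein's inequality the weights have total mass 2 d,
    whence A <= 4 d^2 B. *)

Set Implicit Arguments.
Unset Strict Implicit.
Unset Printing Implicit Defensive.

Import Order.TTheory GRing.Theory Num.Theory numFieldNormedType.Exports.

Local Open Scope classical_set_scope.
Local Open Scope ring_scope.

(** * Scalars and the real inner product *)

(** The estimate on the tree carries the factor s and says nothing at s = 0, the only value that the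
    embedding needs; hence the extrapolation from parameters s_j = t_j^2 / b. If the j-th sample
    enters with a coefficient of modulus at most w_j t_j, Cauchy-Schwarz produces sum_j w_j times
    sum_j w_j t_j^2 <A_I W(I) v_I(s_j), W(I) v_I(s_j)>, and after summation over the atoms the tree
    estimate bounds the j-th term by w_j b ||f||^2. The constant is thus (sum_j w_j)^2 b, where
    coefficients are measured relative to t_j. The matrix T changes from atom to atom, so one choice
    of nodes, depending on d only, has to serve all polynomials of degree less than d at once; with
    x = cos phi one has t = tan (phi / 2), and at the Chebyshev angles the sum of the weights can be
    computed in closed form. A second obstacle is that W(I) may be singular: v_I(s) is some solution
    of its equation rather than an inverse applied to F_I, and W^(1/2) is inverted on its range
    only. *)

Section scalar_field.
Context {R : realType} {k : scalar_kind}.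
Local Notation K := (base_field R k).
Implicit Types x y : K.

Lemma sre_is_additive : zmod_morphism (@sre R k).
Proof. by case: k => x y //=; case: x y => [a b] [c d]. Qed.
HB.instance Definition _ := GRing.isZmodMorphism.Build K R (@sre R k) sre_is_additive.

Lemma sim_is_additive : zmod_morphism (@sim R k).
Proof. by case: k => x y /=; [rewrite subr0|case: x y => [a b] [c d]]. Qed.
HB.instance Definition _ := GRing.isZmodMorphism.Build K R (@sim R k) sim_is_additive.

Lemma sconj_is_additive : zmod_morphism (@sconj R k).
Proof. by case: k => x y //=; exact: raddfB. Qed.
HB.instance Definition _ :=
  GRing.isZmodMorphism.Build K K (@sconj R k) sconj_is_additive.

Lemma sconj_is_multiplicative : monoid_morphism (@sconj R k).
Proof. by case: k; split => //= [|x y]; [exact: conjc1|exact: rmorphM]. Qed.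
HB.instance Definition _ :=
  GRing.isMonoidMorphism.Build K K (@sconj R k) sconj_is_multiplicative.

Lemma sreal_is_additive : zmod_morphism (@sreal R k).
Proof. by rewrite /sreal; case: k => x y //=; apply/eqP; rewrite eq_complex /= subr0 !eqxx. Qed.
HB.instance Definition _ :=
  GRing.isZmodMorphism.Build R K (@sreal R k) sreal_is_additive.

Lemma sreal_is_multiplicative : monoid_morphism (@sreal R k).
Proof.
rewrite /sreal; case: k; split => //= x y; apply/eqP.
by rewrite eq_complex /= !mul0r !mulr0 subr0 addr0 !eqxx.
Qed.
HB.instance Definition _ :=
  GRing.isMonoidMorphism.Build R K (@sreal R k) sreal_is_multiplicative.

Lemma scalar_ext x y : sre x = sre y -> sim x = sim y -> x = y.
Proof. by move: x y; case: k => //= -[a b] [c d] /= -> ->. Qed.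

Lemma sre_smk a b : sre (smk a b : K) = a.
Proof. by case: k. Qed.

Lemma sim_sreal a : sim (sreal a : K) = 0.
Proof. by case: k. Qed.

Lemma sre_sreal a : sre (sreal a : K) = a.
Proof. exact: sre_smk. Qed.

Lemma sre_conj x : sre (sconj x) = sre x.
Proof. by move: x; case: k => //= -[]. Qed.

Lemma sim_conj x : sim (sconj x) = - sim x.
Proof. by move: x; case: k => [x|[]] //=; rewrite oppr0. Qed.

Lemma sconjK : involutive (@sconj R k).
Proof. by case: k => //=; exact: conjcK. Qed.

Lemma sconj_sreal a : sconj (sreal a : K) = sreal a.
Proof. by rewrite /sreal; case: k => //=; rewrite oppr0. Qed.

Lemma sreM x y : sre (x * y) = sre x * sre y - sim x * sim y.
Proof. by move: x y; case: k => [x y|[a b] [c d]] //=; rewrite mul0r subr0. Qed.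

Lemma simM x y : sim (x * y) = sre x * sim y + sim x * sre y.
Proof.
by move: x y; case: k => [x y|[a b] [c d]] //=; rewrite ?mul0r ?mulr0 ?addr0.
Qed.

Lemma scalar_ge0 x : (0 <= x) = (sim x == 0) && (0 <= sre x).
Proof.
move: x; case: k => [x|[a b]] /=; first by rewrite eqxx.
by rewrite lecE.
Qed.

Lemma sreZ a x : sre (sreal a * x) = a * sre x.
Proof. by rewrite sreM sre_sreal sim_sreal mul0r subr0. Qed.

Lemma simZ a x : sim (sreal a * x) = a * sim x.
Proof. by rewrite simM sre_sreal sim_sreal mul0r addr0. Qed.

End scalar_field.

Section real_inner_product.
Context {R : realType} {k : scalar_kind}.
Local Notation K := (base_field R k).

Lemma adjmxD m n (M N : 'M[K]_(m, n)) : adjmx (M + N) = adjmx M + adjmx N.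
Proof. by rewrite /adjmx linearD map_mxD. Qed.

Lemma adjmxB m n (M N : 'M[K]_(m, n)) : adjmx (M - N) = adjmx M - adjmx N.
Proof. by rewrite /adjmx linearB map_mxB. Qed.

Lemma adjmxZ m n a (M : 'M[K]_(m, n)) : adjmx (sreal a *: M) = sreal a *: adjmx M.
Proof. by rewrite /adjmx linearZ map_mxZ /= sconj_sreal. Qed.

Lemma adjmx0 m n : adjmx (0 : 'M[K]_(m, n)) = 0.
Proof. by rewrite /adjmx trmx0 map_mx0. Qed.

Lemma adjmx1 n : adjmx (1%:M : 'M[K]_n) = 1%:M.
Proof. by rewrite /adjmx trmx1 map_mx1. Qed.

Lemma adjmxM m n p (M : 'M[K]_(m, n)) (N : 'M[K]_(n, p)) :
  adjmx (M *m N) = adjmx N *m adjmx M.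
Proof. by rewrite /adjmx trmx_mul map_mxM. Qed.

Lemma adjmxK m n (M : 'M[K]_(m, n)) : adjmx (adjmx M) = M.
Proof. by apply/matrixP => i j; rewrite !mxE sconjK. Qed.

Lemma adjmx_sum m n I (r : seq I) (P : pred I) (M : I -> 'M[K]_(m, n)) :
  adjmx (\sum_(i <- r | P i) M i) = \sum_(i <- r | P i) adjmx (M i).
Proof. by rewrite /adjmx raddf_sum /= (raddf_sum (map_mx _)). Qed.

Definition rdiag n (D : 'I_n -> R) : 'M[K]_n := diag_mx (\row_i sreal (D i)).

Lemma rdiagE n (D : 'I_n -> R) (u : 'cV[K]_n) i :
  (rdiag D *m u) i 0 = sreal (D i) * u i 0.
Proof. by rewrite mul_diag_mx !mxE. Qed.

Lemma adjmx_rdiag n (D : 'I_n -> R) : adjmx (rdiag D) = rdiag D.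
Proof.
by apply/matrixP => i j; rewrite !mxE eq_sym raddfMn /= sconj_sreal; case: eqP => [->|].
Qed.

Lemma mul_rdiag n (D E : 'I_n -> R) :
  rdiag D *m rdiag E = rdiag (fun i => D i * E i).
Proof.
by rewrite mulmx_diag; congr diag_mx; apply/rowP => i; rewrite !mxE rmorphM.
Qed.

Lemma rdiag1 n : rdiag (fun=> 1 : R) = 1%:M :> 'M[K]_n.
Proof. by rewrite -diag_const_mx; congr diag_mx; apply/rowP => i; rewrite !mxE rmorph1. Qed.

Lemma rdiagD n (D E : 'I_n -> R) :
  rdiag D + rdiag E = rdiag (fun i => D i + E i).
Proof. by rewrite /rdiag -linearD; congr diag_mx; apply/rowP => i; rewrite !mxE rmorphD. Qed.

Context {d : nat}.
Implicit Types (u v w : 'cV[K]_d) (M N : 'M[K]_d).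

(** Taking real parts gives a real Euclidean space over both fields at once; quadratic forms of
    self-adjoint matrices lose nothing, see [psdmxP]. *)
Definition rip u v : R := sre (inner u v).

Lemma ripE u v : rip u v =
  \sum_i (sre (u i 0) * sre (v i 0) + sim (u i 0) * sim (v i 0)).
Proof.
rewrite /rip /inner raddf_sum; apply: eq_bigr => i _ /=.
by rewrite sreM sre_conj sim_conj mulrN opprK.
Qed.

Lemma ripC u v : rip u v = rip v u.
Proof. by rewrite !ripE; apply: eq_bigr => i _; rewrite mulrC [sim _ * _]mulrC. Qed.

Lemma ripDl u v w : rip (u + v) w = rip u w + rip v w.
Proof.
rewrite !ripE -big_split; apply: eq_bigr => i _ /=.
by rewrite mxE !raddfD /=; ring.
Qed.

Lemma ripZl a u v : rip (sreal a *: u) v = a * rip u v.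
Proof.
rewrite !ripE mulr_sumr; apply: eq_bigr => i _ /=.
by rewrite mxE sreZ simZ; ring.
Qed.

Lemma ripDr u v w : rip w (u + v) = rip w u + rip w v.
Proof. by rewrite ripC ripDl !(ripC w). Qed.

Lemma ripZr a u v : rip u (sreal a *: v) = a * rip u v.
Proof. by rewrite ripC ripZl ripC. Qed.

Lemma scalerN1 m n (M : 'M[K]_(m, n)) : - M = sreal (- 1) *: M.
Proof. by rewrite rmorphN1 scaleN1r. Qed.

Lemma ripNl u v : rip (- u) v = - rip u v.
Proof. by rewrite scalerN1 ripZl mulN1r. Qed.

Lemma ripNr u v : rip u (- v) = - rip u v.
Proof. by rewrite ripC ripNl ripC. Qed.

Lemma rip0l u : rip 0 u = 0.
Proof. by rewrite -(scale0r (0 : 'cV[K]_d)) -(rmorph0 (@sreal R k)) ripZl mul0r. Qed.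

Lemma rip0r u : rip u 0 = 0.
Proof. by rewrite ripC rip0l. Qed.

Lemma rip_suml I (r : seq I) (P : pred I) (u : I -> 'cV[K]_d) v :
  rip (\sum_(i <- r | P i) u i) v = \sum_(i <- r | P i) rip (u i) v.
Proof.
by apply: (big_ind2 (fun x y => rip x v = y)) => //;
  [exact: rip0l|move=> ? ? ? ? <- <-; exact: ripDl].
Qed.

Lemma rip_ge0 u : 0 <= rip u u.
Proof. by rewrite ripE; apply: sumr_ge0 => i _; rewrite addr_ge0 // -expr2 sqr_ge0. Qed.

Lemma rip_eq0 u : rip u u = 0 -> u = 0.
Proof.
move=> /eqP; rewrite ripE psumr_eq0; last first.
  by move=> i _; rewrite addr_ge0 // -expr2 sqr_ge0.
move=> /allP u0; apply/colP => i; rewrite mxE.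
have := u0 i (mem_index_enum _); rewrite /= -!expr2 paddr_eq0 ?sqr_ge0 //.
rewrite !sqrf_eq0 => /andP[/eqP a /eqP b].
by apply: scalar_ext; rewrite ?a ?b raddf0.
Qed.

Lemma vnorm_sqr u : vnorm u ^+ 2 = rip u u.
Proof. by rewrite /vnorm sqr_sqrtr // rip_ge0. Qed.

Lemma inner_adj M u v : inner (M *m u) v = inner u (adjmx M *m v).
Proof.
have innerE (a b : 'cV[K]_d) : inner a b = (adjmx b *m a) 0 0.
  by rewrite mxE; apply: eq_bigr => i _; rewrite !mxE mulrC.
by rewrite !innerE adjmxM adjmxK mulmxA.
Qed.

Lemma rip_adj M u v : rip (M *m u) v = rip u (adjmx M *m v).
Proof. by rewrite /rip inner_adj. Qed.

Lemma inner_conj u v : sconj (inner u v) = inner v u.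
Proof. by rewrite /inner rmorph_sum; apply: eq_bigr => i _; rewrite rmorphM /= sconjK mulrC. Qed.

(** Self-adjointness alone makes <M u, u> real, since it equals its own conjugate; positivity can
    then be tested on real parts. *)
Lemma psdmxP M : psdmx M <-> adjmx M = M /\ forall u, 0 <= rip (M *m u) u.
Proof.
split=> -[MM M0]; split => // u; have := M0 u; first by rewrite scalar_ge0 => /andP[].
rewrite scalar_ge0 => ->; rewrite andbT.
have /(congr1 sim) : sconj (inner (M *m u) u) = inner (M *m u) u.
  by rewrite inner_conj inner_adj MM.
rewrite sim_conj => /eqP; rewrite eq_sym -subr_eq0 opprK -mulr2n mulrn_eq0 /=.
by move=> /eqP ->.
Qed.

Lemma psdmx0 : psdmx (0 : 'M[K]_d).
Proof. by apply/psdmxP; split=> [|u]; rewrite ?adjmx0 // mul0mx rip0l. Qed.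

Lemma psdmxD M N : psdmx M -> psdmx N -> psdmx (M + N).
Proof.
move=> /psdmxP[Ma M0] /psdmxP[Na N0]; apply/psdmxP; split; first by rewrite adjmxD Ma Na.
by move=> u; rewrite mulmxDl ripDl addr_ge0.
Qed.

Lemma psdmx_sum I (r : seq I) (P : pred I) (M : I -> 'M[K]_d) :
  (forall i, P i -> psdmx (M i)) -> psdmx (\sum_(i <- r | P i) M i).
Proof.
by move=> M0; apply: (big_ind (fun M => psdmx M)) => //; [exact: psdmx0|exact: psdmxD].
Qed.

Lemma psdmxZ a M : 0 <= a -> psdmx M -> psdmx (sreal a *: M).
Proof.
move=> a0 /psdmxP[Ma M0]; apply/psdmxP; split; first by rewrite adjmxZ Ma.
by move=> u; rewrite -scalemxAl ripZl mulr_ge0.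
Qed.

Lemma psdmx_congr M N : psdmx M -> psdmx (adjmx N *m M *m N).
Proof.
move=> /psdmxP[Ma M0]; apply/psdmxP; split; first by rewrite !adjmxM adjmxK Ma mulmxA.
by move=> u; rewrite -!mulmxA rip_adj adjmxK.
Qed.

Lemma loewner_leP M N : adjmx M = M -> adjmx N = N ->
  (forall u, rip (M *m u) u <= rip (N *m u) u) -> loewner_le M N.
Proof.
move=> Ma Na MN; apply/psdmxP; split; first by rewrite adjmxB Ma Na.
by move=> u; rewrite mulmxBl ripDl ripNl subr_ge0.
Qed.

Lemma loewner_rip M N u : loewner_le M N -> rip (M *m u) u <= rip (N *m u) u.
Proof. by move=> /psdmxP[_ /(_ u)]; rewrite mulmxBl ripDl ripNl subr_ge0. Qed.

End real_inner_product.

(** * Extrapolation from Chebyshev nodes *)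

Section chebyshev_nodes.
Context {R : realType}.
Variable d : nat.
Hypothesis d_gt0 : (0 < d)%N.

(** The zeros of cos (d phi) between 0 and pi; their cosines are the Chebyshev nodes. *)
Let phi (j : nat) : R := (2 * j%:R + 1) * (pi / (2 * d%:R)).
Let dR_gt0 : 0 < d%:R :> R. Proof. by rewrite ltr0n. Qed.

Lemma node_angle_bounds (j : 'I_d) : 0 < phi j < pi.
Proof.
apply/andP; split.
  by rewrite mulr_gt0 ?divr_gt0 ?pi_gt0 ?mulr_gt0 // ltr_wpDl ?mulr_ge0.
rewrite /phi mulrA ltr_pdivrMr ?mulr_gt0 // [ltRHS]mulrC ltr_pM2r ?pi_gt0 //.
by rewrite -!natrM natr1 ltr_nat; have := ltn_ord j; lia.
Qed.

Lemma node_angle_mul j : d%:R * phi j = pi / 2 + pi *+ j.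
Proof. by rewrite /phi -[pi *+ j]mulr_natr; field; rewrite gt_eqF. Qed.

Lemma sin_node j : sin (d%:R * phi j) = (-1) ^+ j.
Proof. by rewrite node_angle_mul (alternatingn (@sinDpi R)) sin_pihalf mulr1. Qed.

Lemma cos_node j : cos (d%:R * phi j) = 0.
Proof. by rewrite node_angle_mul (alternatingn (@cosDpi R)) cos_pihalf mulr0. Qed.

(** With al = pi / (2 d), multiplication by 2 sin (m al) makes the sum telescope to sin (m pi) = 0;
    the bounds on m place m al strictly between 0 and pi, so the factor can be cancelled. *)
Lemma sum_cos_nodes m : (0 < m < 2 * d)%N -> \sum_(j < d) cos (m%:R * phi j) = 0.
Proof.
move=> /andP[m0 md]; set al : R := pi / (2 * d%:R).
have s0 : sin (m%:R * al) != 0.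
  rewrite gt_eqF // sin_gt0_pi // mulr_gt0 ?ltr0n ?divr_gt0 ?pi_gt0 ?mulr_gt0 //=.
  rewrite mulrA ltr_pdivrMr ?mulr_gt0 // [ltRHS]mulrC ltr_pM2r ?pi_gt0 //.
  by rewrite -natrM ltr_nat.
apply: (mulfI (x := 2 * sin (m%:R * al))); first by rewrite mulf_neq0.
rewrite mulr0 mulr_sumr.
pose f (j : nat) := sin (m%:R * (2 * j%:R) * al).
transitivity (\sum_(0 <= j < d) (f j.+1 - f j)).
  rewrite big_mkord; apply: eq_bigr => j _; rewrite /f /phi -/al.
  have -> : m%:R * (2 * j.+1%:R) * al = m%:R * ((2 * j%:R + 1) * al) + m%:R * al.
    by rewrite -natr1; ring.
  have -> : m%:R * (2 * j%:R) * al = m%:R * ((2 * j%:R + 1) * al) - m%:R * al by ring.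
  by rewrite sinD sinB; ring.
rewrite telescope_sumr // /f mulr0 mulr0 mul0r sin0 subr0.
have -> : m%:R * (2 * d%:R) * al = 0 + pi *+ m.
  by rewrite /al -[pi *+ m]mulr_natr; field; rewrite gt_eqF.
by rewrite (alternatingn (@sinDpi R)) sin0 mulr0.
Qed.

(** The sign (-1)^j is sin (d phi_j), so for 0 < k < d each term is half the difference of the
    cosines of frequencies d - k and d + k, both covered by [sum_cos_nodes]. *)
Lemma sum_sin_nodes k : (k <= d)%N ->
  \sum_(j < d) (-1) ^+ j * sin (k%:R * phi j) = if k == d then d%:R else 0.
Proof.
move=> kd; have [->|k_neq_d] := eqVneq k d.
  under eq_bigr do rewrite sin_node -expr2 sqrr_sign.
  by rewrite sumr_const card_ord.
have [->|k0] := posnP k.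
  by rewrite big1 // => j _; rewrite mul0r sin0 mulr0.
have E j : (-1) ^+ j * sin (k%:R * phi j) =
    (cos ((d - k)%:R * phi j) - cos ((d + k)%:R * phi j)) / 2.
  rewrite -sin_node.
  have -> : (d - k)%:R * phi j = d%:R * phi j - k%:R * phi j by rewrite natrB // mulrBl.
  have -> : (d + k)%:R * phi j = d%:R * phi j + k%:R * phi j by rewrite natrD mulrDl.
  by rewrite cosB cosD; field.
under eq_bigr do rewrite E.
by rewrite -mulr_suml sumrB !sum_cos_nodes ?subrr ?mul0r //; lia.
Qed.

Let x (j : nat) : R := cos (phi j).

Lemma node_lt1 (j : 'I_d) : x j < 1.
Proof.
have /andP[a b] := node_angle_bounds j.
by rewrite -cos0 ltr_cos // in_itv /= ?lexx ?pi_ge0 // !ltW.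
Qed.

Lemma node_gtN1 (j : 'I_d) : -1 < x j.
Proof.
have /andP[a b] := node_angle_bounds j.
by rewrite -cospi ltr_cos // in_itv /= ?lexx ?pi_ge0 // !ltW.
Qed.

Let node_neq1 (j : 'I_d) : 1 - cos (phi j) != 0.
Proof. by rewrite gt_eqF // subr_gt0 node_lt1. Qed.

Let dR_neq0 : d%:R != 0 :> R. Proof. by rewrite gt_eqF. Qed.

Let S (k : nat) := \sum_(j < d) (-1) ^+ j * sin (k%:R * phi j) / (d%:R * (1 - x j)).

(* The second differences of S are multiples of the sums in [sum_sin_nodes]. *)
Lemma weighted_sum_sin_nodes k : (k <= d)%N -> S k = k%:R.
Proof.
have S2 n : S n.+2 - S n.+1 = S n.+1 - S n
    - 2 / d%:R * \sum_(j < d) (-1) ^+ j * sin (n.+1%:R * phi j).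
  rewrite /S -!sumrB mulr_sumr -sumrB; apply: eq_bigr => j _.
  have -> : n.+2%:R * phi j = n.+1%:R * phi j + phi j by rewrite -[n.+2%:R]natr1; ring.
  have -> : n%:R * phi j = n.+1%:R * phi j - phi j by rewrite -[n.+1%:R]natr1; ring.
  rewrite sinD sinB /x; field.
  by rewrite dR_neq0 node_neq1.
have S0 : S 0 = 0 by rewrite /S big1 // => j _; rewrite mul0r sin0 mulr0 mul0r.
(* Since cos (d phi_j) = 0, [S] is symmetric about d; its second difference there is -2, so the last
   first difference is 1. The earlier second differences vanish, which propagates the slope 1 down
   to [S 0 = 0]. *)
have Ssym : S d.+1 = S d.-1.
  apply: eq_bigr => j _; congr (_ * _ / _).
  have -> : d.+1%:R * phi j = d%:R * phi j + phi j by rewrite -[d.+1%:R]natr1; ring.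
  have -> : d.-1%:R * phi j = d%:R * phi j - phi j.
    have -> : d%:R = d.-1%:R + 1 :> R by rewrite natr1 prednK.
    by ring.
  by rewrite sinD sinB cos_node; ring.
have Slast : S d - S d.-1 = 1.
  have := S2 d.-1; rewrite prednK // sum_sin_nodes // eqxx Ssym divfK ?gt_eqF //.
  by lra.
have Sdiff i : (i < d)%N -> S (d - i) - S (d - i).-1 = 1.
  elim: i => [_|i IH id]; first by rewrite subn0.
  have := S2 (d - i.+1).-1; rewrite prednK ?subn_gt0 // sum_sin_nodes ?leq_subr //.
  rewrite ifF; last by lia.
  have -> : (d - i.+1).+1 = (d - i)%N by lia.
  have := IH (ltnW id); have -> : (d - i).-1 = (d - i.+1)%N by lia.
  by lra.
elim: k => [_|k IH kd]; first by rewrite S0.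
have /Sdiff : (d - k.+1 < d)%N by lia.
by rewrite subKn //= (IH (ltnW kd)) -natr1 => /eqP; rewrite subr_eq addrC => /eqP.
Qed.

(** By 2 sin (k phi) cos phi = sin ((k + 1) phi) + sin ((k - 1) phi), each power of the node shifts
    the frequency by one, and k + m < d keeps all frequencies below d, where the alternating sums
    vanish. *)
Lemma sum_sin_node_pow m k : (k + m < d)%N ->
  \sum_(j < d) (-1) ^+ j * sin (k%:R * phi j) * x j ^+ m = 0.
Proof.
elim: m k => [|m IH] k kmd.
  under eq_bigr do rewrite mulr1.
  by rewrite addn0 in kmd; rewrite (sum_sin_nodes (ltnW kmd)) ltn_eqF.
case: k kmd => [|k] kmd.
  by rewrite big1 // => j _; rewrite mul0r sin0 mulr0 mul0r.
have E j : (-1) ^+ j * sin (k.+1%:R * phi j) * x j ^+ m.+1 =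
   ((-1) ^+ j * sin (k.+2%:R * phi j) * x j ^+ m +
    (-1) ^+ j * sin (k%:R * phi j) * x j ^+ m) / 2.
  have -> : k.+2%:R * phi j = k.+1%:R * phi j + phi j by rewrite -[k.+2%:R]natr1; ring.
  have -> : k%:R * phi j = k.+1%:R * phi j - phi j by rewrite -[k.+1%:R]natr1; ring.
  by rewrite sinD sinB exprS /x; field.
under eq_bigr do rewrite E.
by rewrite -mulr_suml big_split /= !IH ?addr0 ?mul0r //; lia.
Qed.

(* The weights are the values at 1 of the Lagrange polynomials of the Chebyshev
   nodes. *)
Lemma chebyshev_interpolation (q : {poly R}) : (size q <= d)%N ->
  \sum_(j < d) (-1) ^+ j * sin (phi j) / (d%:R * (1 - x j)) * q.[x j] = q.[1].
Proof.
move=> qd.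
(* Writing q = q(1) + r (X - 1) cancels the denominators 1 - x_j in the part with r, which has
   degree at most d - 2 and sums to zero by [sum_sin_node_pow]; the constant q(1) is left with total
   weight [S 1 = 1]. *)
have /factor_theorem[r qr] : root (q - q.[1]%:P) 1.
  by rewrite rootE !hornerE subrr.
have r_size : (size r < d)%N.
  have [->|r0] := eqVneq r 0; first by rewrite size_poly0.
  have := size_Mmonic r0 (monicXsubC (1 : R)); rewrite -qr size_XsubC addn2 /= => <-.
  by rewrite (leq_trans (size_polyD _ _)) // size_polyN geq_max qd (leq_trans (size_polyC_leq1 _)).
have qE y : q.[y] = q.[1] + r.[y] * (y - 1).
  by have := congr1 (fun p => p.[y]) qr; rewrite !hornerE => <-; ring.
have E (j : 'I_d) : (-1) ^+ j * sin (phi j) / (d%:R * (1 - x j)) * q.[x j] =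
   (-1) ^+ j * sin (1%:R * phi j) / (d%:R * (1 - x j)) * q.[1]
   - d%:R^-1 * \sum_(m < size r) r`_m * ((-1) ^+ j * sin (1%:R * phi j) * x j ^+ m).
  rewrite qE (horner_coef r) mul1r.
  rewrite [X in _ = _ - _ * X](eq_bigr (fun m : 'I__ => (-1) ^+ j * sin (phi j) * (r`_m * x j ^+ m))); last first.
    by move=> m _; ring.
  rewrite -mulr_sumr; set t := \sum_(_ < _) _.
  field; by rewrite dR_neq0 node_neq1.
under eq_bigr do rewrite E.
rewrite sumrB -mulr_suml [X in X * _](weighted_sum_sin_nodes d_gt0) mul1r.
rewrite -mulr_sumr exchange_big big1 ?mulr0 ?subr0 // => m _.
by rewrite -mulr_sumr sum_sin_node_pow ?mulr0 // (leq_ltn_trans _ r_size) // add1n.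
Qed.

(** At frequency d the sine cancels the sign, so the left-hand side is twice [S d]. *)
Lemma sum_inv_nodes : \sum_(j < d) 2 / (d%:R * (1 - x j)) = 2 * d%:R.
Proof.
rewrite -[in RHS](weighted_sum_sin_nodes (leqnn d)) mulr_sumr; apply: eq_bigr => j _.
by rewrite sin_node -expr2 sqrr_sign mul1r.
Qed.

Lemma extrapolation_nodes : exists t c w : 'I_d -> R,
  [/\ forall j, 0 <= w j, \sum_j w j = 2 * d%:R,
      forall j, `|c j| * (1 + t j ^+ 2) ^+ d = w j * t j &
      forall (l : 'I_d -> R) i,
        \sum_j c j * \prod_(m | m != i) (1 + t j ^+ 2 * l m) = 1].
Proof.
have s0 (j : 'I_d) : 0 < sin (phi j) by rewrite sin_gt0_pi // node_angle_bounds.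
have x1 (j : 'I_d) : 1 - x j != 0 by rewrite gt_eqF // subr_gt0 node_lt1.
have x2 (j : 'I_d) : 1 + x j != 0 by rewrite gt_eqF // -ltrBlDl sub0r node_gtN1.
have tE (j : 'I_d) : (sin (phi j) / (1 + x j)) ^+ 2 = (1 - x j) / (1 + x j).
  rewrite expr_div_n sin2cos2 -/(x j); field; exact: x2.
have tE1 (j : 'I_d) : 1 + (sin (phi j) / (1 + x j)) ^+ 2 = 2 / (1 + x j).
  by rewrite tE; field; exact: x2.
exists (fun j => sin (phi j) / (1 + x j)).
exists (fun j => (-1) ^+ j * sin (phi j) / (d%:R * (1 - x j)) *
  ((1 + x j) / 2) ^+ d.-1).
exists (fun j => 2 / (d%:R * (1 - x j))).
split.
- by move=> j; rewrite divr_ge0 // mulr_ge0 // subr_ge0 ltW // node_lt1.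
- exact: sum_inv_nodes.
- move=> j; rewrite tE1 !normrM normr_sign mul1r normfV normrM.
  rewrite !ger0_norm ?exprn_ge0 ?divr_ge0 ?subr_ge0 //;
    try by rewrite ltW ?node_lt1 // -ltrBlDl sub0r node_gtN1.
  have powE (y : R) : y ^+ d = y * y ^+ d.-1 by rewrite -exprS prednK.
  have : ((1 + x j) / 2) ^+ d.-1 * (2 / (1 + x j)) ^+ d.-1 = 1.
    by rewrite -exprMn mulrC mulrA divfK // divff ?expr1n.
  rewrite powE; set u := _ ^+ d.-1; set v := _ ^+ d.-1 => uv.
  transitivity (sin (phi j) / (d%:R * (1 - x j)) * (2 / (1 + x j)) * (u * v)).
    by ring.
  rewrite uv; field; by rewrite x1 x2 dR_neq0.
- move=> l i.
  (* The factor of index m is (1 + x) / 2 times 1 + s l_m, written in x; it equals 1 at x = 1, and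
     omitting i keeps the degree below d. *)
  pose q : {poly R} := \prod_(m | m != i)
    (((1 + l m) / 2)%:P + (1 - l m) / 2 *: 'X).
  have q_size : (size q <= d)%N.
    rewrite (leq_trans (size_prod_leq _ _)) //.
    rewrite leq_subLR cardC1 card_ord.
    rewrite (@leq_trans (\sum_(m < d | m != i) 2).+1) //.
      rewrite ltnS leq_sum // => m _.
      rewrite (leq_trans (size_polyD _ _)) // geq_max.
      by rewrite (leq_trans (size_polyC_leq1 _)) // (leq_trans (size_scale_leq _ _)) ?size_polyX.
    by rewrite sum_nat_const cardC1 card_ord; lia.
  have qE y : q.[y] = \prod_(m | m != i) ((1 + y) / 2 + l m * ((1 - y) / 2)).
    rewrite horner_prod; apply: eq_bigr => m _; rewrite !hornerE /=; by field.
  transitivity q.[1]; last by rewrite qE big1 // => m _; field.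
  rewrite -chebyshev_interpolation //; apply: eq_bigr => j _.
  rewrite -[LHS]mulrA; congr (_ * _); rewrite qE tE.
  have -> : ((1 + x j) / 2) ^+ d.-1 = \prod_(m < d | m != i) ((1 + x j) / 2).
    by rewrite prodr_const cardC1 card_ord.
  rewrite -big_split; apply: eq_bigr => m _ /=.
  field; exact: x2.
Qed.

End chebyshev_nodes.

(** * Spectral theorem and square roots *)

Section spectral_theorem.
Context {R : realType}.

Lemma hermitian_spectral_complex n (M : 'M[base_field R ComplexScalars]_n) :
  adjmx M = M -> exists U (D : 'I_n -> R),
    adjmx U *m U = 1%:M /\ M = adjmx U *m rdiag D *m U.
Proof.
move=> MM.
have Mherm : (M : 'M[R[i]]_n) \is hermsymmx.
  by apply/is_hermitianmxP; rewrite expr0 scale1r -[LHS]MM.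
have /orthomx_spectralP := hermitian_normalmx Mherm.
have PU := spectral_unitarymx (M : 'M[R[i]]_n).
rewrite invmx_unitary // => ME.
exists (spectralmx (M : 'M[R[i]]_n)), (fun i => complex.Re (spectral_diag (M : 'M[R[i]]_n) 0 i)).
split; first exact: (mulmx1C (unitarymxP PU)).
rewrite [LHS]ME; congr (_ *m _ *m _); congr diag_mx; apply/rowP => i; rewrite mxE.
rewrite /sreal /= complexr0 RRe_real //.
exact: (mxOverP (hermitian_spectral_diag_real Mherm)).
Qed.

Lemma row_sqr_gt0 n (v : 'rV[R]_n) : v != 0 -> 0 < (v *m v^T) 0 0.
Proof.
have -> : (v *m v^T) 0 0 = \sum_i v 0 i ^+ 2.
  by rewrite mxE; apply: eq_bigr => i _; rewrite mxE expr2.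
rewrite lt0r sumr_ge0 ?andbT; last by move=> i _; exact: sqr_ge0.
apply: contra; rewrite psumr_eq0; last by move=> i _; exact: sqr_ge0.
move=> /allP v0; apply/eqP/rowP => i; rewrite [RHS]mxE.
by have /(_ i (mem_index_enum _)) := v0; rewrite sqrf_eq0 => /eqP.
Qed.

(** The complexified matrix has a complex eigenvector with a real eigenvalue. The real and imaginary
    parts of this vector satisfy the same equation over R, and they cannot both vanish. *)
Lemma symmetric_eigenvector n (M : 'M[R]_n.+1) : M^T = M ->
  exists2 v : 'rV[R]_n.+1, v *m v^T = 1%:M & exists l, v *m M = l *: v.
Proof.
move=> MM; pose MC : 'M[base_field R ComplexScalars]_n.+1 := map_mx (real_complex R) M.
have MCM : adjmx MC = MC.
  by apply/matrixP => i j; rewrite !mxE -[in RHS]MM mxE /=; exact: conjc_real.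
have [U [D [UU ME]]] := hermitian_spectral_complex MCM.
have UU' : U *m adjmx U = 1%:M := mulmx1C UU.
have r_eig : row 0 U *m MC = (real_complex R (D 0)) *: row 0 U.
  rewrite -row_mul ME !mulmxA UU' mul1mx.
  by apply/rowP => j; rewrite mxE mul_diag_mx !mxE.
have entry (f : {additive R[i] -> R}) (fZ : forall a z, f (z * real_complex R a) = f z * a) :
    map_mx f (row 0 U) *m M = D 0 *: map_mx f (row 0 U).
  have := congr1 (map_mx f) r_eig => /rowP fr; apply/rowP => j.
  have := fr j; rewrite !mxE raddf_sum /= mulrC fZ mulrC => <-.
  by apply: eq_bigr => i _; rewrite !mxE fZ.
have [f fZ fU] : exists2 f : {additive R[i] -> R},
    (forall a z, f (z * real_complex R a) = f z * a) & map_mx f (row 0 U) != 0.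
  have ReZ a z : @sre R ComplexScalars (z * real_complex R a) = @sre R ComplexScalars z * a.
    by case: z => x y /=; rewrite mulr0 subr0.
  have ImZ a z : @sim R ComplexScalars (z * real_complex R a) = @sim R ComplexScalars z * a.
    by case: z => x y /=; rewrite mulr0 add0r.
  have [Re0|] := eqVneq (map_mx (@sre R ComplexScalars) (row 0 U)) 0; last first.
    by exists (@sre R ComplexScalars).
  have [Im0|] := eqVneq (map_mx (@sim R ComplexScalars) (row 0 U)) 0; last first.
    by exists (@sim R ComplexScalars).
  have : row 0 U = 0.
    apply/rowP => j; apply: scalar_ext.
      by have /rowP /(_ j) := Re0; rewrite !mxE => ->.
    by have /rowP /(_ j) := Im0; rewrite !mxE => ->.
  move=> U0; have : (row 0 U *m adjmx U) 0 0 = 1.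
    by rewrite -row_mul UU' !mxE eqxx.
  by rewrite U0 mul0mx mxE => /eqP; rewrite eq_sym oner_eq0.
move: (map_mx f (row 0 U)) (entry f fZ) fU => v v_eig fU.
have vv := row_sqr_gt0 fU.
exists ((Num.sqrt ((v *m v^T) 0 0))^-1 *: v).
  apply/matrixP => i j; rewrite !ord1 linearZ -scalemxAl -scalemxAr scalerA mxE.
  rewrite [RHS]mxE eqxx mulr1n -invfM -expr2 sqr_sqrtr ?ltW // mulVf //.
  by rewrite gt_eqF.
by exists (D 0); rewrite -scalemxAl v_eig !scalerA mulrC.
Qed.

(** The reflection in the hyperplane orthogonal to e - v exchanges the unit vectors e and v. *)
Lemma householder n (e v : 'rV[R]_n) : e *m e^T = 1%:M -> v *m v^T = 1%:M ->
  exists H : 'M[R]_n, [/\ H^T = H, H *m H = 1%:M & e *m H = v].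
Proof.
move=> ee vv; have [<-|ev] := eqVneq e v.
  by exists 1%:M; rewrite trmx1 !mulmx1.
have scal (a b : 'rV[R]_n) : a *m b^T = ((a *m b^T) 0 0)%:M by rewrite [LHS]mx11_scalar.
pose w := e - v; pose c := (w *m w^T) 0 0.
have veq : v *m e^T = e *m v^T by rewrite scal [RHS]scal -[in LHS](trmxK v) -trmx_mul mxE.
have cE : c = 2 * (e *m w^T) 0 0.
  rewrite /c /w linearB /= mulmxBl !mulmxBr ee vv veq !mxE /=.
  by ring.
have c0 : c != 0 by rewrite gt_eqF // row_sqr_gt0 // subr_eq0.
exists (1%:M - (2 / c) *: (w^T *m w)); split.
- by rewrite linearB linearZ /= trmx1 trmx_mul trmxK.
- have PP : w^T *m w *m (w^T *m w) = c *: (w^T *m w).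
    by rewrite -mulmxA [X in _ *m X]mulmxA (scal w) -/c mul_scalar_mx scalemxAr.
  rewrite mulmxBl mul1mx (mulmxBr (_ *: _)) mulmx1 -scalemxAl -scalemxAr PP !scalerA.
  rewrite -mulrA divfK // mulr2n mulrDr mulr1 scalerDl.
  by rewrite opprD opprK !addrA !subrK.
- rewrite mulmxBr mulmx1 -scalemxAr mulmxA (scal e) mul_scalar_mx scalerA.
  have -> : 2 / c * (e *m w^T) 0 0 = 1 by rewrite mulrAC -cE divff.
  by rewrite scale1r opprB addrC subrK.
Qed.

(** Deflation: a reflection moves the first basis vector onto a unit eigenvector, after which the
    first row vanishes off the diagonal, and by symmetry so does the first column. The induction
    applies to the remaining block. *)
Lemma symmetric_spectral_real n (M : 'M[R]_n) : M^T = M ->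
  exists U (D : 'rV[R]_n), U^T *m U = 1%:M /\ M = U^T *m diag_mx D *m U.
Proof.
elim: n M => [|n IH] M MM.
  by exists 1%:M, 0; rewrite !trmx1 !mulmx1 !thinmx0; split => //; rewrite [M]thinmx0 [RHS]thinmx0.
move: M MM; rewrite -[n.+1]/(1 + n)%N => M MM.
have [v vv [l vl]] : exists2 v : 'rV[R]_(1 + n), v *m v^T = 1%:M &
    exists l, v *m M = l *: v by exact: symmetric_eigenvector.
have ee : (delta_mx 0 0 : 'rV[R]_(1 + n)) *m (delta_mx 0 0)^T = 1%:M.
  by rewrite trmx_delta mul_delta_mx; apply/matrixP => i j; rewrite !ord1 !mxE.
have [H [HT HH eH]] := householder ee vv.
pose N : 'M[R]_(1 + n) := H *m M *m H.
have NT : N^T = N by rewrite /N !trmx_mul HT MM mulmxA.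
have eN : delta_mx 0 0 *m N = l *: delta_mx 0 0 :> 'rV[R]_(1 + n).
  by rewrite /N !mulmxA eH vl -scalemxAl -eH -mulmxA HH mulmx1.
have ME : M = H *m N *m H by rewrite /N !mulmxA HH mul1mx -mulmxA HH mulmx1.
clearbody N.
have Nrow i : N 0 i = l *+ (i == 0).
  have := congr1 (fun A : 'rV_(1 + n) => A 0 i) eN.
  by rewrite -rowE !mxE /= mulr_natr => ->.
pose N' := drsubmx N.
have N'T : N'^T = N' by rewrite /N' trmx_drsub NT.
have NE : N = block_mx l%:M 0 0 N'.
  rewrite -[LHS]submxK; congr block_mx.
  - apply/matrixP => i j; rewrite !ord1 !mxE (_ : lshift n 0 = 0) ?Nrow ?eqxx //.
    exact: val_inj.
  - apply/matrixP => i j; rewrite !ord1 !mxE (_ : lshift n 0 = 0) ?Nrow //.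
    exact: val_inj.
  - apply/matrixP => i j; rewrite !ord1 -NT !mxE (_ : lshift n 0 = 0) ?Nrow //.
    exact: val_inj.
have [U' [D' [UU' NE']]] := IH N' N'T.
pose V : 'M[R]_(1 + n) := block_mx (1%:M : 'M[R]_1) 0 0 U'.
exists (V *m H), (row_mx (l%:M : 'M[R]_1) D' : 'rV[R]_(1 + n)).
have UU : V^T *m V = 1%:M.
  rewrite /V tr_block_mx mulmx_block !trmx1 !trmx0 !mul1mx !mul0mx !mulmx0 !addr0 add0r UU'.
  by rewrite -scalar_mx_block.
split; first by rewrite trmx_mul -mulmxA (mulmxA _ V H) UU mul1mx HT HH.
rewrite ME NE trmx_mul HT -!mulmxA; congr (_ *m _); rewrite !mulmxA; congr (_ *m _).
rewrite /V diag_mx_row tr_block_mx !mulmx_block !trmx1 !trmx0.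
rewrite !mul1mx !mul0mx !mulmx0 !addr0 !add0r !mulmx1 !mul0mx -NE'.
by congr block_mx; apply/matrixP => i j; rewrite !ord1 !mxE eqxx.
Qed.

Lemma hermitian_spectral k n (M : 'M[base_field R k]_n) :
  adjmx M = M -> exists U (D : 'I_n -> R),
    adjmx U *m U = 1%:M /\ M = adjmx U *m rdiag D *m U.
Proof.
case: k M => M; last exact: hermitian_spectral_complex.
have adjE m p (N : 'M[base_field R RealScalars]_(m, p)) : adjmx N = N^T.
  by rewrite /adjmx (map_mx_id (f := sconj)).
rewrite adjE => /symmetric_spectral_real[U [D [UU ME]]].
exists U, (fun i => D 0 i); rewrite !adjE; split => //.
by rewrite [LHS]ME; congr (_ *m _ *m _); congr diag_mx; apply/rowP => i; rewrite mxE.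
Qed.

End spectral_theorem.

(** * Functional calculus in an orthonormal eigenbasis *)

Section functional_calculus.
Context {R : realType} {k : scalar_kind}.
Local Notation K := (base_field R k).

(** For unitary U, the matrix with eigenvalues D in the basis given by U. With U fixed, sums and
    products act entrywise on D. *)
Definition fcalc d (U : 'M[K]_d) (D : 'I_d -> R) : 'M[K]_d :=
  adjmx U *m rdiag D *m U.

Context {d : nat}.
Implicit Types (U M A : 'M[K]_d) (D E : 'I_d -> R).

Lemma adjmx_fcalc U D : adjmx (fcalc U D) = fcalc U D.
Proof. by rewrite /fcalc !adjmxM adjmxK adjmx_rdiag mulmxA. Qed.

Lemma fcalcM U D E : adjmx U *m U = 1%:M ->
  fcalc U D *m fcalc U E = fcalc U (fun i => D i * E i).
Proof.
move=> /mulmx1C UU; rewrite /fcalc -mul_rdiag !mulmxA.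
by rewrite -(mulmxA _ U (adjmx U)) UU mulmx1.
Qed.

Lemma fcalcD U D E : fcalc U D + fcalc U E = fcalc U (fun i => D i + E i).
Proof. by rewrite /fcalc -rdiagD mulmxDr mulmxDl. Qed.

Lemma fcalcZ U D a : sreal a *: fcalc U D = fcalc U (fun i => a * D i).
Proof.
rewrite /fcalc scalemxAl scalemxAr; congr (_ *m _ *m _).
by rewrite /rdiag -linearZ; congr diag_mx; apply/rowP => i; rewrite !mxE rmorphM.
Qed.

Lemma eq_fcalc U D E : D =1 E -> fcalc U D = fcalc U E.
Proof. by move=> /funext ->. Qed.

Lemma fcalc1 U : adjmx U *m U = 1%:M -> fcalc U (fun=> 1) = 1%:M.
Proof. by rewrite /fcalc rdiag1 mulmx1. Qed.

Lemma fcalc_sum I (r : seq I) U (D : I -> 'I_d -> R) :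
  \sum_(j <- r) fcalc U (D j) = fcalc U (fun i => \sum_(j <- r) D j i).
Proof.
elim: r => [|j r IH].
  rewrite big_nil (@eq_fcalc _ _ (fun=> 0 * 0)); last by move=> i; rewrite big_nil mulr0.
  by rewrite -fcalcZ raddf0 scale0r.
by rewrite big_cons IH fcalcD; apply: eq_fcalc => i; rewrite big_cons.
Qed.

Lemma psdmx_fcalc U D : (forall i, 0 <= D i) -> psdmx (fcalc U D).
Proof.
move=> D0; apply: psdmx_congr; apply/psdmxP; split; first exact: adjmx_rdiag.
move=> u; rewrite ripE; apply: sumr_ge0 => i _; rewrite rdiagE sreZ simZ -!mulrA -mulrDr.
by rewrite mulr_ge0 // addr_ge0 // -expr2 sqr_ge0.
Qed.

(** The vector is a unit eigenvector, so bounds on the quadratic form turn into bounds on the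
    eigenvalues D. *)
Lemma rip_fcalc_unit U D i : adjmx U *m U = 1%:M ->
  let u := adjmx U *m delta_mx i 0 in rip (fcalc U D *m u) u = D i /\ rip u u = 1.
Proof.
move=> UU u; have UUC := mulmx1C UU.
have delta1 (a : R) : rip (sreal a *: delta_mx i 0) (delta_mx i 0 : 'cV[K]_d) = a.
  rewrite ripZl ripE (bigD1 i) //= big1 => [|j ji].
    by rewrite !mxE !eqxx -(rmorph1 (@sreal R k)) sre_sreal sim_sreal mulr0 !addr0 !mulr1.
  by rewrite !mxE (negbTE ji) !raddf0 mulr0 addr0.
split; last first.
  by rewrite /u rip_adj adjmxK mulmxA UUC mul1mx -(delta1 1) rmorph1 scale1r.
have -> : fcalc U D *m u = adjmx U *m (sreal (D i) *: delta_mx i 0).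
  rewrite /fcalc /u -!mulmxA (mulmxA U) UUC mul1mx; congr (_ *m _).
  apply/colP => j; rewrite rdiagE !mxE.
  by case: (eqVneq j i) => [->//|]; rewrite !mulr0.
by rewrite rip_adj adjmxK mulmxA UUC mul1mx delta1.
Qed.

Lemma psd_spectral M : psdmx M -> exists U D,
  [/\ adjmx U *m U = 1%:M, M = fcalc U D & forall i, 0 <= D i].
Proof.
move=> /psdmxP[MM M0]; have [U [D [UU ME]]] := hermitian_spectral MM.
exists U, D; split => // i.
by have [<- _] := rip_fcalc_unit D i UU; rewrite -/(fcalc U D) in ME; rewrite -ME.
Qed.

Lemma sqrtmx_spec M : psdmx M -> psdmx (sqrtmx M) /\ sqrtmx M *m sqrtmx M = M.
Proof.
move=> /psd_spectral[U [D [UU ME D0]]].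
suff [S S_sqrt] : exists S, psdmx S /\ S *m S = M.
  by rewrite /sqrtmx; case: xgetP => [N -> []//|/(_ S)].
exists (fcalc U (fun i => Num.sqrt (D i))); split.
  by apply: psdmx_fcalc => i; rewrite sqrtr_ge0.
by rewrite fcalcM // ME; apply: eq_fcalc => i; rewrite -expr2 sqr_sqrtr.
Qed.

Lemma sqrtmx_norm M (u : 'cV[K]_d) : psdmx M ->
  vnorm (sqrtmx M *m u) ^+ 2 = rip (M *m u) u.
Proof.
move=> /sqrtmx_spec[/psdmxP[S_adj _] SS].
by rewrite vnorm_sqr rip_adj S_adj mulmxA SS ripC.
Qed.

Lemma psdmx_ker M (u : 'cV[K]_d) : psdmx M -> rip (M *m u) u = 0 -> M *m u = 0.
Proof.
move=> M0; rewrite -sqrtmx_norm // vnorm_sqr => /rip_eq0 Su.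
by have [_ <-] := sqrtmx_spec M0; rewrite -mulmxA Su mulmx0.
Qed.

Lemma eq_mx_mulcol M A : (forall u : 'cV[K]_d, M *m u = A *m u) -> M = A.
Proof.
move=> MA; apply/matrixP => i j.
by have /colP /(_ i) := MA (delta_mx j 0); rewrite -!colE !mxE.
Qed.

(** A Cauchy-Schwarz inequality, proved termwise in the expanded double sum: by positivity at t_i
    G_i + t_j G_j and t_i G_i - t_j G_j, the product t_i t_j |<A G_i, G_j>| is at most the mean of
    the two diagonal terms t_i^2 <A G_i, G_i> and t_j^2 <A G_j, G_j>. *)
Lemma psdmx_jensen n A (G : 'I_n -> 'cV[K]_d) (a t w : 'I_n -> R) : psdmx A ->
  (forall j, 0 <= w j) -> (forall j, `|a j| <= w j * t j) ->
  rip (A *m (\sum_j sreal (a j) *: G j)) (\sum_j sreal (a j) *: G j) <=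
  (\sum_j w j) * \sum_j w j * (t j ^+ 2 * rip (A *m G j) (G j)).
Proof.
move=> /psdmxP[AA A0] w0 aw.
have t0 j : 0 <= w j * t j by exact: le_trans (aw j).
pose B x y := rip (A *m x) y.
have BC x y : B x y = B y x by rewrite /B rip_adj AA ripC.
have B2 x y : 2 * `|B x y| <= B x x + B y y.
  have h1 := A0 (x + y); have h2 := A0 (x - y).
  have e1 : B (x + y) (x + y) = B x x + 2 * B x y + B y y.
    by rewrite /B mulmxDr !ripDl !ripDr -/(B y x) -/(B x y) (BC y x) /B; ring.
  have e2 : B (x - y) (x - y) = B x x - 2 * B x y + B y y.
    rewrite /B mulmxBr !ripDl !ripDr !ripNl !ripNr -/(B y x) -/(B x y) (BC y x) /B.
    by ring.
  rewrite -/(B _ _) e1 in h1; rewrite -/(B _ _) e2 in h2.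
  move: h1 h2; set bxy := B x y; set bx := B x x; set by' := B y y => h1 h2.
  by case: (ger0P bxy) => ?; lra.
have expand : rip (A *m (\sum_j sreal (a j) *: G j)) (\sum_j sreal (a j) *: G j) =
    \sum_i \sum_j a i * a j * B (G i) (G j).
  rewrite mulmx_sumr rip_suml; apply: eq_bigr => i _.
  rewrite ripC rip_suml; apply: eq_bigr => j _.
  by rewrite ripZl -scalemxAr ripZr ripC /B; ring.
rewrite expand.
pose q j := w j * (t j ^+ 2 * B (G j) (G j)).
have qE : (\sum_j w j) * (\sum_j q j) = \sum_i \sum_j (w i * q j + w j * q i) / 2.
  transitivity (((\sum_j w j) * (\sum_j q j) + (\sum_j w j) * (\sum_j q j)) / 2); first by field.
  rewrite {1}mulr_suml [X in (_ + X) / 2]mulrC [X in (_ + X) / 2]mulr_suml -big_split mulr_suml.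
  apply: eq_bigr => i _; rewrite !mulr_sumr -big_split mulr_suml; apply: eq_bigr => j _ /=.
  by rewrite [q i * _]mulrC.
rewrite -/q qE; apply: ler_sum => i _; apply: ler_sum => j _.
rewrite (le_trans (ler_norm _)) // !normrM.
have h : `|a i| * `|a j| <= (w i * t i) * (w j * t j) by exact: ler_pM.
rewrite (le_trans (ler_wpM2r (normr_ge0 _) h)) //.
(* Only w t >= 0 is known, so the sign of t is available where the weight is nonzero; a zero weight
   makes both sides vanish. *)
have [wi|wi] := eqVneq (w i) 0.
  by rewrite /q wi !mul0r mulr0 addr0 mul0r.
have [wj|wj] := eqVneq (w j) 0.
  by rewrite /q wj !(mul0r, mulr0) addr0 mul0r.
have ti : 0 <= t i by have := t0 i; rewrite pmulr_rge0 // lt0r wi w0.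
have tj : 0 <= t j by have := t0 j; rewrite pmulr_rge0 // lt0r wj w0.
have := B2 (sreal (t i) *: G i) (sreal (t j) *: G j).
rewrite /B -!scalemxAr !ripZl !ripZr -!/(B _ _) !normrM (ger0_norm ti) (ger0_norm tj) => Bij.
have ww : 0 <= w i * w j by exact: mulr_ge0.
have := ler_wpM2l ww Bij; rewrite /q !expr2.
set nB := `|B _ _|; set bi := B _ _; set bj := B _ _.
by move=> ?; nra.
Qed.

End functional_calculus.

(** * Interpolation of resolvents *)

Section resolvent_interpolation.
Context {R : realType} {k : scalar_kind} {d : nat}.
Local Notation K := (base_field R k).
Variables t c w : 'I_d -> R.
Hypothesis w_ge0 : forall j, 0 <= w j.
Hypothesis ctw : forall j, `|c j| * (1 + t j ^+ 2) ^+ d = w j * t j.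
Hypothesis extrapolation : forall (l : 'I_d -> R) i,
  \sum_j c j * \prod_(m | m != i) (1 + t j ^+ 2 * l m) = 1.

(* With M = W^(1/2) T W^(1/2) and F = W^(1/2) h, the vector W v(s), where
   (W + s M) v(s) = F, is W^(1/2) (1 + s T)^(-1) h. Up to the factor
   det (1 + s T) <= (1 + s)^d it is polynomial in s of degree less than d, hence
   F = W v(0) is an explicit combination of the W v(s_j). *)
Lemma resolvent_interpolation (W M A : 'M[K]_d) (F : 'cV[K]_d) (b : R) :
  psdmx W -> psdmx M -> psdmx A -> 0 < b -> loewner_le M (sreal b *: W) ->
  (forall u, W *m u = 0 -> rip F u = 0) ->
  exists v : 'I_d -> 'cV[K]_d,
    (forall j, (W + sreal (t j ^+ 2 / b) *: M) *m v j = F) /\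
    rip (A *m F) F <= (\sum_j w j) *
      \sum_j w j * (t j ^+ 2 * rip (A *m (W *m v j)) (W *m v j)).
Proof.
move=> W0 M0 A0 b_gt0 MW FW.
have [U [D [UU WE D0]]] := psd_spectral W0.
(* [Rt] is W^(1/2). Because 0^-1 = 0, [Q] is its pseudoinverse, and [P], with eigenvalues r / r
   equal to 0 or 1, is the orthogonal projection onto the range of W. *)
pose r i := Num.sqrt (D i); pose Rt := fcalc U r; pose Q := fcalc U (fun i => (r i)^-1).
pose P := fcalc U (fun i => r i / r i).
have rr i : r i * r i = D i by rewrite -expr2 sqr_sqrtr.
have rrr i : r i * (r i / r i) = r i.
  by have [->|r0] := eqVneq (r i) 0; rewrite ?mul0r // divff // mulr1.
have RtRt : Rt *m Rt = W by rewrite fcalcM // WE; apply: eq_fcalc.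
have RtQ : Rt *m Q = P by rewrite fcalcM.
have QRt : Q *m Rt = P by rewrite fcalcM //; apply: eq_fcalc => i; rewrite mulrC.
have RtP : Rt *m P = Rt by rewrite fcalcM //; apply: eq_fcalc.
have PP : P *m P = P.
  by rewrite -{1}QRt -mulmxA RtP QRt.
have P_adj : adjmx P = P := adjmx_fcalc U _.
have Q_adj : adjmx Q = Q := adjmx_fcalc U _.
clearbody Rt Q P.
have WP : W *m (1%:M - P) = 0 by rewrite mulmxBr mulmx1 -RtRt -mulmxA RtP subrr.
have M_adj : adjmx M = M by have /psdmxP[] := M0.
(* M <= b W forces the form of M, hence M itself, to vanish on the kernel of W. *)
have MP : M *m P = M.
  apply: eq_mx_mulcol => u; apply/eqP; rewrite eq_sym -subr_eq0 -mulmxA -mulmxBr.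
  rewrite -{1}[u]mul1mx -mulmxBl; apply/eqP/psdmx_ker => //.
  set x := _ *m u; apply/le_anti/andP; split; last by have /psdmxP[_ ->] := M0.
  rewrite (le_trans (loewner_rip _ MW)) // -scalemxAl ripZl /x mulmxA WP mul0mx.
  by rewrite rip0l mulr0.
have PM : P *m M = M by rewrite -[RHS]M_adj -[in RHS]MP adjmxM P_adj M_adj.
have PF : P *m F = F.
  apply/eqP; rewrite eq_sym -subr_eq0; apply/eqP/rip_eq0.
  have -> : F - P *m F = (1%:M - P) *m F by rewrite mulmxBl mul1mx.
  rewrite rip_adj adjmxB adjmx1 P_adj mulmxA.
  have -> : (1%:M - P) *m (1%:M - P) = 1%:M - P.
    by rewrite mulmxBr mulmx1 mulmxBl mul1mx PP subrr subr0.
  by apply: FW; rewrite mulmxA WP mul0mx.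
pose T := sreal b^-1 *: (Q *m M *m Q).
have T0 : psdmx T.
  apply: psdmxZ; first by rewrite invr_ge0 ltW.
  by rewrite -[X in X *m M]Q_adj; apply: psdmx_congr.
have [V [L [VV TE L0]]] := psd_spectral T0.
(* T <= Q W Q = P <= 1: the first inequality is the hypothesis on M at Q u, the second is |(1 - P)
   u|^2 >= 0. *)
have L1 i : L i <= 1.
  have [] := rip_fcalc_unit L i VV; rewrite -TE; set u := adjmx V *m _ => TL u1.
  rewrite -TL -[leRHS]u1 /T -scalemxAl ripZl -!mulmxA rip_adj Q_adj.
  rewrite (le_trans (ler_wpM2l _ (loewner_rip (Q *m u) MW))) ?invr_ge0 ?(ltW b_gt0) //.
  rewrite -scalemxAl ripZl mulrA mulVf ?gt_eqF // mul1r.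
  rewrite -{2}Q_adj -rip_adj !mulmxA -RtRt -!mulmxA (mulmxA Q) QRt (mulmxA Rt Q) RtQ.
  rewrite mulmxA PP.
  have : 0 <= rip ((1%:M - P) *m u) ((1%:M - P) *m u) by exact: rip_ge0.
  rewrite rip_adj adjmxB adjmx1 P_adj mulmxA.
  have -> : (1%:M - P) *m (1%:M - P) = 1%:M - P.
    by rewrite mulmxBr mulmx1 mulmxBl mul1mx PP subrr subr0.
  by rewrite mulmxBl mul1mx ripDr ripNr subr_ge0 (ripC u).
pose s j := t j ^+ 2.
have s0 j : 0 <= s j by exact: sqr_ge0.
have sL j i : 1 + s j * L i != 0 by rewrite gt_eqF // ltr_pwDl // mulr_ge0.
pose D' j := fcalc V (fun i => (1 + s j * L i)^-1).
pose h := Q *m F.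
have Rth : Rt *m h = F by rewrite /h mulmxA RtQ.
pose v j := Q *m (D' j *m h).
have Wv j : W *m v j = Rt *m (D' j *m h).
  by rewrite /v mulmxA -RtRt -(mulmxA Rt) RtQ RtP.
have RtT : Rt *m T = sreal b^-1 *: (M *m Q).
  by rewrite /T -scalemxAr !mulmxA RtQ PM.
exists v; split.
  move=> j; rewrite mulmxDl Wv -scalemxAl /v.
  have -> : sreal (t j ^+ 2 / b) *: (M *m (Q *m (D' j *m h))) =
      Rt *m (sreal (s j) *: (T *m (D' j *m h))).
    by rewrite -scalemxAr (mulmxA Rt T) RtT -scalemxAl scalerA -rmorphM (mulmxA M Q).
  rewrite -mulmxDr -[RHS]Rth; congr (_ *m _).
  rewrite (mulmxA T) scalemxAl -mulmxDl TE fcalcM // fcalcZ fcalcD.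
  rewrite (@eq_fcalc _ _ _ _ _ (fun=> 1)) ?fcalc1 ?mul1mx // => i.
  by field.
(* On the i-th eigenvector of T the determinant det (1 + s_j T) cancels the denominator of the
   resolvent and leaves the product over m != i, which [extrapolation] sums to 1. By [L1] the
   determinant is at most (1 + s_j)^d, whence |a_j| <= w_j t_j. *)
pose a j := c j * \prod_m (1 + s j * L m).
have FE : F = \sum_j sreal (a j) *: (W *m v j).
  transitivity (Rt *m ((\sum_j sreal (a j) *: D' j) *m h)).
    rewrite (eq_bigr _ (fun j _ => fcalcZ V _ (a j))) fcalc_sum.
    rewrite (@eq_fcalc _ _ _ _ _ (fun=> 1)) ?fcalc1 ?mul1mx // => i.
    rewrite -[RHS](extrapolation L i); apply: eq_bigr => j _.
    by rewrite /a (bigD1 i) //= -/(s j); field.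
  rewrite mulmx_suml mulmx_sumr; apply: eq_bigr => j _.
  by rewrite Wv -scalemxAl -scalemxAr.
have aw j : `|a j| <= w j * t j.
  rewrite -ctw normrM ler_wpM2l //.
  rewrite -[X in _ <= _ ^+ X]card_ord -prodr_const normr_prod ler_prod // => m _.
  rewrite normr_ge0 /= ger0_norm; last by rewrite addr_ge0 // mulr_ge0.
  rewrite lerD2l.
  by rewrite -[leRHS]mulr1 ler_wpM2l.
by rewrite [in leLHS]FE; apply: psdmx_jensen.
Qed.

End resolvent_interpolation.

(** * The inequality on finite trees of atoms *)

Section atoms_of_a_filtration.
Context {R : realType} {disp : measure_display} {X : measurableType disp}.
Context {sigma : set X -> \bar R} (F : atomic_filtration sigma).

(** I belongs to the sigma-algebra of its rank, hence to that of the later rank of J, so it is a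
    union of atoms of that rank: J is one of them or is disjoint from all of them. *)
Lemma atom_nested (I J : set X * int) : atoms F I -> atoms F J -> I.2 <= J.2 ->
  J.1 `<=` I.1 \/ I.1 `&` J.1 = set0.
Proof.
move=> FI FJ IJ.
have [S SJ IE] := filt_atomic (filt_increasing IJ (rank_atoms_filt FI)).
have [SJ1|SJ1] := pselect (S J.1); first by left; rewrite IE => x Jx; exists J.1.
right; rewrite IE setI_bigcupl; apply: bigcup0 => K SK; rewrite -subset0 => x [Kx Jx].
by apply: SJ1; have -> : J.1 = K by apply: (rank_atoms_disjoint FJ (SJ _ SK)); exists x.
Qed.

Lemma atom_sub_refl (I : set X * int) : atom_sub I I.
Proof. by split. Qed.

Lemma atom_sub_trans (I J K : set X * int) :
  atom_sub I J -> atom_sub J K -> atom_sub I K.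
Proof. by move=> [IJ rIJ] [JK rJK]; split; [exact: subset_trans JK|exact: le_trans rIJ]. Qed.

Lemma atom_sub_anti (I J : set X * int) : atom_sub I J -> atom_sub J I -> I = J.
Proof.
move: I J => [I m] [J n] [/= IJ rIJ] [/= JI rJI].
by congr (_, _); [rewrite eqEsubset|apply/le_anti/andP].
Qed.

End atoms_of_a_filtration.

Lemma minimal_rank {T : eqType} (r : T -> int) (s : seq T) : s != [::] ->
  exists2 x, x \in s & forall y, y \in s -> r x <= r y.
Proof.
elim: s => [//|x s IH] _; have [->|/IH[y ys ymin]] := eqVneq s [::].
  by exists x; rewrite ?mem_head // => y; rewrite inE => /eqP ->.
have [xy|yx] := leP (r x) (r y).
  exists x; rewrite ?mem_head // => z; rewrite inE => /orP[/eqP -> //|/ymin].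
  exact: le_trans.
exists y; rewrite ?inE ?ys ?orbT // => z; rewrite inE => /orP[/eqP ->|/ymin //].
exact: ltW.
Qed.

Section tree_inequality.
Context {R : realType} {k : scalar_kind} {disp : measure_display}
  {X : measurableType disp} {sigma : set X -> \bar R}
  (F : atomic_filtration sigma) {d : nat}.
Local Notation K := (base_field R k).
Local Notation atom := (set X * int)%type.
Variables (E : set (set X)) (W : set X -> 'M[K]_d) (f : set X -> 'cV[K]_d)
  (N : set X -> R) (A : atom -> 'M[K]_d).
Hypothesis E_atom : forall I, atoms F I -> E I.1.
Hypothesis E_setD : forall G H, E G -> E H -> E (G `\` H).
Hypothesis W_psd : forall G, E G -> psdmx (W G).
Hypothesis A_psd : forall I, atoms F I -> psdmx (A I).
Hypothesis W_setD : forall G H, E G -> E H -> H `<=` G -> W G = W H + W (G `\` H).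
Hypothesis f_setD : forall G H, E G -> E H -> H `<=` G -> f G = f H + f (G `\` H).
Hypothesis N_setD : forall G H, E G -> E H -> H `<=` G -> N G = N H + N (G `\` H).
Hypothesis energy : forall G u, E G -> 2 * rip (f G) u - rip (W G *m u) u <= N G.

Definition waw (I : atom) : 'M[K]_d := W I.1 *m A I *m W I.1.

Lemma waw_psd I : atoms F I -> psdmx (waw I).
Proof.
move=> FI; have /psdmxP[WW _] := W_psd (E_atom FI).
by rewrite /waw -[X in X *m A I]WW; apply: psdmx_congr; exact: A_psd.
Qed.

Lemma rip_waw I u : atoms F I ->
  rip (waw I *m u) u = rip (A I *m (W I.1 *m u)) (W I.1 *m u).
Proof.
move=> FI; have /psdmxP[WW _] := W_psd (E_atom FI).
by rewrite /waw -!mulmxA rip_adj WW.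
Qed.

Definition subtree (J : seq atom) (I : atom) : 'M[K]_d :=
  \sum_(I' <- J | `[< atom_sub I' I >]) waw I'.

Lemma subtree_psd J I : (forall I', I' \in J -> atoms F I') -> psdmx (subtree J I).
Proof.
move=> JF; rewrite /subtree big_seq_cond; apply: psdmx_sum => I' /andP[/JF FI' _].
exact: waw_psd.
Qed.

(** The difference of the two sides is the form of H at u - v. *)
Lemma quadratic_max (H : 'M[K]_d) (g v u : 'cV[K]_d) : psdmx H -> H *m v = g ->
  2 * rip g u - rip (H *m u) u <= 2 * rip g v - rip (H *m v) v.
Proof.
move=> /psdmxP[HH H0] <-; have := H0 (u - v).
rewrite mulmxBr !ripDl !ripDr !ripNl !ripNr.
have -> : rip (H *m u) v = rip (H *m v) u by rewrite rip_adj HH ripC.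
by lra.
Qed.

(* Induction on the tree: the atom I of minimal rank splits G into I and G \ I,
   and testing the inequality for the descendants of I at the vector v I produces
   the term of I. *)
Lemma tree_inequality (s : R) (v : atom -> 'cV[K]_d) (J : seq atom) (G : set X) :
  0 <= s -> uniq J -> E G ->
  (forall I, I \in J -> [/\ atoms F I, I.1 !=set0 & I.1 `<=` G]) ->
  (forall I, I \in J -> (W I.1 + sreal s *: subtree J I) *m v I = f I.1) ->
  forall u, 2 * rip (f G) u - rip ((W G + sreal s *: \sum_(I <- J) waw I) *m u) u
    + s * (\sum_(I <- J) rip (A I *m (W I.1 *m v I)) (W I.1 *m v I)) <= N G.
Proof.
move=> s0; move: {2}(size J) (leqnn (size J)) => n.
elim: n J G => [|n IH] J G Jn uJ EG JG Jv u.
  have -> : J = [::] by apply: size0nil; lia.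
  by rewrite !big_nil scaler0 addr0 mulr0 addr0 energy.
have [->|J0] := eqVneq J [::]; first by rewrite !big_nil scaler0 addr0 mulr0 addr0 energy.
have [I IJ Imin] := minimal_rank snd J0.
have [FI I_ne IG] := JG I IJ.
pose below I' := `[< atom_sub I' I >].
pose J1 := [seq I' <- J | below I' && (I' != I)].
pose J2 := [seq I' <- J | ~~ below I'].
have JB (V : nmodType) (g : atom -> V) :
    \sum_(I' <- J | below I') g I' = g I + \sum_(I' <- J1) g I'.
  rewrite -[LHS]big_filter (bigD1_seq I) ?filter_uniq //=; last first.
    by rewrite mem_filter IJ andbT; apply/asboolP; exact: atom_sub_refl.
  by rewrite big_filter_cond -[RHS]/(_ + _) [in RHS]big_filter.
have JE (V : nmodType) (g : atom -> V) :
    \sum_(I' <- J) g I' = g I + \sum_(I' <- J1) g I' + \sum_(I' <- J2) g I'.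
  by rewrite (bigID below) /= JB; congr (_ + _); rewrite [RHS]big_filter.
have sub_small (p : pred atom) : ~~ p I -> (size [seq I' <- J | p I'] <= n)%N.
  move=> pI; rewrite -ltnS (leq_trans _ Jn) // size_filter -(count_predC p J).
  by rewrite -[ltnLHS]addn0 ltn_add2l -has_count; apply/hasP; exists I.
have J1_small : (size J1 <= n)%N by apply: sub_small; rewrite eqxx andbF.
have J2_small : (size J2 <= n)%N.
  by apply: sub_small; rewrite negbK; apply/asboolP; exact: atom_sub_refl.
have subtreeE (p : pred atom) I' :
    (forall I'', I'' \in J -> atom_sub I'' I' -> p I'') ->
    subtree [seq I'' <- J | p I''] I' = subtree J I'.
  move=> pI'; rewrite /subtree big_filter_cond big_seq_cond [RHS]big_seq_cond.
  apply: eq_bigl => I''; case: (boolP (I'' \in J)) => //= I''J.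
  by case: asboolP => [/(pI' _ I''J) -> //|_]; rewrite andbF.
have IH1 := IH J1 I.1 J1_small (filter_uniq _ uJ) (E_atom FI) _ _ (v I).
have {IH1} IH1 := IH1 _ _.
have {}IH1 : 2 * rip (f I.1) (v I) - rip ((W I.1 + sreal s *: \sum_(I' <- J1) waw I') *m v I) (v I)
    + s * (\sum_(I' <- J1) rip (A I' *m (W I'.1 *m v I')) (W I'.1 *m v I')) <= N I.1.
  apply: IH1 => I'; rewrite mem_filter => /andP[/andP[/asboolP I'I nI'I] I'J].
    by have [? ? _] := JG _ I'J; split => //; case: I'I.
  rewrite subtreeE ?Jv // => I'' I''J I''I'; apply/andP; split.
    by apply/asboolP; exact: atom_sub_trans I'I.
  by apply: contra nI'I => /eqP I''I; apply/eqP/atom_sub_anti => //; rewrite -I''I.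
have IH2 := IH J2 (G `\` I.1) J2_small (filter_uniq _ uJ) (E_setD EG (E_atom FI)) _ _ u.
have {IH2} IH2 : 2 * rip (f (G `\` I.1)) u
    - rip ((W (G `\` I.1) + sreal s *: \sum_(I' <- J2) waw I') *m u) u
    + s * (\sum_(I' <- J2) rip (A I' *m (W I'.1 *m v I')) (W I'.1 *m v I')) <= N (G `\` I.1).
  apply: IH2 => I'; rewrite mem_filter => /andP[/asboolP I'I I'J];
    have [FI' I'_ne I'G] := JG _ I'J; have rI' := Imin _ I'J.
    split => // x I'x; split; first exact: I'G.
    move=> Ix; have [I'subI|II'] := atom_nested FI FI' rI'; first exact: I'I.
    by have : (I.1 `&` I'.1) x by []; rewrite II'.
  (* If some I'' below I' were also below I, a point of I'' would lie in both I and I', and I' would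
     be below I because the rank of I is minimal. This is where atoms have to be nonempty. *)
  rewrite subtreeE ?Jv // => I'' I''J I''I'; apply/asboolP => I''I.
  have [_ [x I''x] _] := JG _ I''J.
  have [I'subI|II'] := atom_nested FI FI' rI'; first by apply: I'I.
  have : (I.1 `&` I'.1) x by split; [case: I''I => + _; apply|case: I''I' => + _; apply].
  by rewrite II'.
have subI : subtree J I = waw I + \sum_(I' <- J1) waw I' by exact: JB.
have Hpsd : psdmx (W I.1 + sreal s *: subtree J I).
  apply: psdmxD; first exact: W_psd (E_atom FI).
  by apply: psdmxZ => //; apply: subtree_psd => I' /JG[].
(* The form in [IH1] involves the strict descendants of I only. Subtracting s <waw I v, v> from it
   and adding the same quantity as the term of I in the sum gives the full form at its maximizer
   [v I], which may then be replaced by u; [IH2] is taken at the same u. *)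
have := quadratic_max u Hpsd (Jv I IJ).
rewrite subI in Hpsd *.
rewrite !JE (W_setD EG (E_atom FI) IG) (f_setD EG (E_atom FI) IG).
rewrite (N_setD EG (E_atom FI) IG) -rip_waw //.
move: IH1 IH2.
rewrite !(scalerDr, mulmxDl, ripDl, ripDr) -!scalemxAl !ripZl.
by rewrite !mulrDr; lra.
Qed.

End tree_inequality.

Section finite_carleson.
Context {R : realType} {k : scalar_kind} {disp : measure_display}
  {X : measurableType disp} {sigma : set X -> \bar R}
  (F : atomic_filtration sigma) {d : nat}.
Local Notation K := (base_field R k).
Local Notation atom := (set X * int)%type.
Variables (E : set (set X)) (W : set X -> 'M[K]_d) (f : set X -> 'cV[K]_d)
  (N : set X -> R) (A : atom -> 'M[K]_d).
Hypothesis E_atom : forall I, atoms F I -> E I.1.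
Hypothesis E_setD : forall G H, E G -> E H -> E (G `\` H).
Hypothesis W_psd : forall G, E G -> psdmx (W G).
Hypothesis A_psd : forall I, atoms F I -> psdmx (A I).
Hypothesis W_setD : forall G H, E G -> E H -> H `<=` G -> W G = W H + W (G `\` H).
Hypothesis f_setD : forall G H, E G -> E H -> H `<=` G -> f G = f H + f (G `\` H).
Hypothesis N_setD : forall G H, E G -> E H -> H `<=` G -> N G = N H + N (G `\` H).
Hypothesis energy : forall G u, E G -> 2 * rip (f G) u - rip (W G *m u) u <= N G.

Lemma finite_carleson (b : R) (J : seq atom) (G : set X) :
  0 < b -> uniq J -> E G ->
  (forall I, I \in J -> [/\ atoms F I, I.1 !=set0 & I.1 `<=` G]) ->
  (forall I, I \in J -> loewner_le (subtree W A J I) (sreal b *: W I.1)) ->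
  \sum_(I <- J) rip (A I *m f I.1) (f I.1) <= 4 * d%:R ^+ 2 * b * N G.
Proof.
move=> b0 uJ EG JG Jb.
have N0 : 0 <= N G.
  by have := energy 0 EG; rewrite !rip0r mulr0 subr0.
have [d0|d0] := posnP d.
  rewrite big1 => [|I _]; first by rewrite d0 expr0n mulr0 mul0r mul0r.
  by rewrite ripE big1 // => i; have := ltn_ord i; rewrite [X in (_ < X)%N]d0.
have [t [c [w [w0 wE ctw ext]]]] := @extrapolation_nodes R d d0.
(* On the kernel of W(I) the left-hand side of the energy bound is linear in u; the multiple chosen
   makes it N + 1. *)
have f_ker I : atoms F I -> forall u, W I.1 *m u = 0 -> rip (f I.1) u = 0.
  move=> FI u Wu; apply/eqP; apply: contraT => r0.
  have := energy (sreal ((N I.1 + 1) / (2 * rip (f I.1) u)) *: u) (E_atom FI).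
  rewrite -scalemxAr Wu scaler0 rip0l subr0 ripZr mulrCA -mulrA.
  rewrite [X in _ * X](_ : _ = 1); last by field.
  by rewrite mulr1; lra.
have vE (I : atom) : exists vI : 'I_d -> 'cV[K]_d, I \in J ->
    (forall j, (W I.1 + sreal (t j ^+ 2 / b) *: subtree W A J I) *m vI j = f I.1) /\
    rip (A I *m f I.1) (f I.1) <= (\sum_j w j) *
      \sum_j w j * (t j ^+ 2 * rip (A I *m (W I.1 *m vI j)) (W I.1 *m vI j)).
  have [IJ|] := boolP (I \in J); last by exists (fun=> 0).
  have [FI _ _] := JG I IJ.
  have Mpsd : psdmx (subtree W A J I).
    by apply: (subtree_psd E_atom W_psd A_psd) => I' /JG[].
  have [vI [h1 h2]] := resolvent_interpolation w0 ctw ext (W_psd (E_atom FI)) Mpsd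
    (A_psd FI) b0 (Jb I IJ) (f_ker I FI).
  by exists vI.
have [v vP] := choice vE.
rewrite (@le_trans _ _ (\sum_(I <- J) (2 * d%:R) *
    \sum_j w j * (t j ^+ 2 * rip (A I *m (W I.1 *m v I j)) (W I.1 *m v I j)))) //.
  rewrite big_seq [leRHS]big_seq; apply: ler_sum => I IJ.
  by have [_] := vP I IJ; rewrite wE.
rewrite -mulr_sumr exchange_big /=.
have -> : 4 * d%:R ^+ 2 * b * N G = 2 * d%:R * \sum_j w j * (b * N G).
  by rewrite -mulr_suml wE; ring.
apply: ler_wpM2l; first by rewrite mulr_ge0.
apply: ler_sum => j _; rewrite -mulr_sumr; apply: ler_wpM2l => //.
have s0 : 0 <= t j ^+ 2 / b by rewrite divr_ge0 ?sqr_ge0 // ltW.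
(* At u = 0 only the sum over the atoms survives on the left; with s = t_j^2 / b it is, after
   multiplication by b, the required bound b N for the j-th sample. *)
have := tree_inequality E_atom E_setD W_psd A_psd W_setD f_setD N_setD energy s0 uJ EG JG
  (v := fun I => v I j) (fun I IJ => (vP I IJ).1 j) 0.
rewrite !rip0r mulr0 subrr add0r -mulr_sumr; set S := \sum_(I <- J) _ => SN.
have := ler_wpM2l (ltW b0) SN.
by have -> : b * (t j ^+ 2 / b * S) = t j ^+ 2 * S by field; rewrite gt_eqF.
Qed.

End finite_carleson.

(** * The trace measure and the density *)

Section local_sets.
Context {R : realType} {disp : measure_display} {X : measurableType disp}.
Context {sigma : set X -> \bar R} (F : atomic_filtration sigma).
Local Notation lm := (local_measurable F).

Lemma atom_measurable I : atoms F I -> measurable I.1.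
Proof. by move=> FI; exact: filt_measurable (rank_atoms_filt FI). Qed.

Lemma lm_measurable E : lm E -> measurable E.
Proof.
move=> [E' [S [mE' finS SF ->]]]; apply: measurableI => //.
by apply: fin_bigcup_measurable => // I /SF; exact: atom_measurable.
Qed.

Lemma lm_setI E G : lm E -> measurable G -> lm (E `&` G).
Proof.
move=> [E' [S [mE' finS SF ->]]] mG; exists (E' `&` G), S; split => //.
  exact: measurableI.
by rewrite setIAC.
Qed.

Lemma lm_subset E G : lm E -> measurable G -> G `<=` E -> lm G.
Proof. by move=> lmE mG GE; rewrite -(setIidr GE); exact: lm_setI. Qed.

Lemma lm_setD E G : lm E -> lm G -> lm (E `\` G).
Proof.
move=> lmE lmG; rewrite setDE; apply: lm_setI => //.
by apply: measurableC; exact: lm_measurable.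
Qed.

Lemma lm_setU E G : lm E -> lm G -> lm (E `|` G).
Proof.
move=> lmE lmG; have mE := lm_measurable lmE; have mG := lm_measurable lmG.
move: (lmE) (lmG) => [E' [S [mE' finS SF EE]]] [G' [T [mG' finT TF GE]]].
exists (E `|` G), (S `|` T); split; [exact: measurableU|by rewrite finite_setU| |].
  by move=> I [/SF|/TF].
rewrite bigcup_setU setIC; apply/esym/setIidr => x [].
  by rewrite EE => -[_ ?]; left.
by rewrite GE => -[_ ?]; right.
Qed.

Lemma lm_set0 : lm set0.
Proof. by exists set0, set0; split => //; rewrite set0I. Qed.

Lemma lm_atom I : atoms F I -> lm I.1.
Proof.
move=> FI; exists setT, [set I]; split => //; first by move=> J ->.
by rewrite bigcup_set1 setTI.
Qed.

Lemma lm_bigsetU (s : seq (set X * int)) : (forall I, I \in s -> atoms F I) ->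
  lm (\big[setU/set0]_(I <- s) I.1).
Proof.
elim: s => [|I s IH] sF; first by rewrite big_nil; exact: lm_set0.
rewrite big_cons; apply: lm_setU; first by apply: lm_atom; apply: sF; rewrite mem_head.
by apply: IH => J Js; apply: sF; rewrite inE Js orbT.
Qed.

Lemma atoms_countable : countable (atoms F).
Proof.
have -> : atoms F = \bigcup_(n in [set: int]) [set (I, n) | I in rank_atoms F n].
  apply/seteqP; split=> [[I n] FI|[I n] [m _ [J FJ [<- <-]]]] //.
  by exists n => //; exists I.
apply: bigcup_countable => // n _; apply: sub_countable (rank_atoms_countable F n).
exact: card_image_le.
Qed.

Lemma local_partition : exists G : (set X)^nat,
  [/\ forall n, lm (G n), trivIset setT G & \bigcup_(I in atoms F) I.1 = \bigcup_n G n].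
Proof.
have /countable_injP[g g_inj] := atoms_countable.
pose U n := \bigcup_(I in [set I | atoms F I /\ g I = n]) I.1.
have lmU n : lm (U n).
  have [[I [FI gI]]|noI] := pselect (exists I, atoms F I /\ g I = n).
    rewrite /U (_ : [set _ | _] = [set I]) ?bigcup_set1; first exact: lm_atom.
    apply/seteqP; split=> [J [FJ gJ]|J -> //].
    by apply: g_inj; rewrite ?inE // gI.
  rewrite /U (_ : [set _ | _] = set0) ?bigcup_set0; first exact: lm_set0.
  by rewrite -subset0 => I FI; apply: noI; exists I.
have mU n : measurable (U n) by exact: lm_measurable.
exists (seqDU U); split.
- by move=> n; apply: (lm_subset (lmU n)); [exact: seqDU_measurable|exact: subset_seqDU].
- exact: trivIset_seqDU.
- rewrite -seqDU_bigcup_eq; apply/seteqP; split=> [x [I FI Ix]|x [n _ [I [FI _] Ix]]].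
    by exists (g I) => //; exists I.
  by exists I.
Qed.

Lemma lm_sub_atoms E : lm E -> E `<=` \bigcup_(I in atoms F) I.1.
Proof. by move=> [E' [S [_ _ SF ->]]] x [_ [I SI Ix]]; exists I => //; exact: SF. Qed.

Definition local_additive (w : set X -> R) := forall E : (set X)^nat,
  (forall n, lm (E n)) -> trivIset setT E -> lm (\bigcup_n E n) ->
  \sum_(0 <= m < n) w (E m) @[n --> \oo] --> w (\bigcup_n E n).

Variable w : set X -> R.
Hypothesis w_add : local_additive w.

Lemma local_additive0 : w set0 = 0.
Proof.
have := @w_add (fun=> set0); rewrite bigcup0 // => /(_ _ _ lm_set0) w0.
have {}w0 : series (fun=> w set0) @ \oo --> w set0.
  by apply: w0 => [_|]; [exact: lm_set0|exact: trivIset_set0].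
have /cvg_series_cvg_0 : cvg (series (fun=> w set0) @ \oo) by apply/cvg_ex; exists (w set0).
by move=> /(cvg_unique _ (cvg_cst (w set0))) ->.
Qed.

Lemma local_additiveU E G : lm E -> lm G -> E `&` G = set0 -> w (E `|` G) = w E + w G.
Proof.
move=> lmE lmG EG.
have := @w_add (bigcup2 E G); rewrite bigcup2E -trivIset_bigcup2.
have lmEG : lm (E `|` G) by exact: lm_setU.
have lm2 n : lm (bigcup2 E G n) by case: n => [|[|n]] //; exact: lm_set0.
move=> /(_ lm2 EG lmEG) wEG.
have : \sum_(0 <= m < n) w (bigcup2 E G m) @[n --> \oo] --> w E + w G.
  apply: cvg_near_cst; exists 2%N => // -[|[|n]] // _ /=.
  rewrite !big_nat_recl //= big1 ?addr0 // => i _; exact: local_additive0.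
by move=> /(cvg_lim (@Rhausdorff R)) <-; rewrite (cvg_lim (@Rhausdorff R) wEG).
Qed.

Lemma local_additiveD E G : lm E -> lm G -> G `<=` E -> w E = w G + w (E `\` G).
Proof.
move=> lmE lmG GE; rewrite -local_additiveU ?setDUK //; first exact: lm_setD.
by rewrite setDIK.
Qed.

End local_sets.

Section trace_measure_theory.
Context {R : realType} {k : scalar_kind} {disp : measure_display}
  {X : measurableType disp} {sigma : set X -> \bar R}
  {F : atomic_filtration sigma} {d : nat}.
Local Notation K := (base_field R k).
Variable W : matrix_measure k F d.
Local Notation lm := (local_measurable F).

Definition trW (E : set X) : R := sre (\tr (W E)).

Lemma sre_entry_additive i j : local_additive F (fun E => sre (W E i j)).
Proof. by move=> E lmE tE lmUE; have [] := mxm_sigma_additive W lmE tE lmUE i j. Qed.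

Lemma sim_entry_additive i j : local_additive F (fun E => sim (W E i j)).
Proof. by move=> E lmE tE lmUE; have [] := mxm_sigma_additive W lmE tE lmUE i j. Qed.

Lemma trWE E : trW E = \sum_i sre (W E i i).
Proof. by rewrite /trW /mxtrace raddf_sum. Qed.

Lemma trW_additive : local_additive F trW.
Proof.
move=> E lmE tE lmUE; rewrite trWE.
have -> : (fun n => \sum_(0 <= m < n) trW (E m)) =
    (fun n => \sum_i \sum_(0 <= m < n) sre (W (E m) i i)).
  by apply/funext => n; rewrite exchange_big; apply: eq_bigr => m _; rewrite trWE.
apply: cvg_big => [|i _]; [exact: add_continuous|exact: sre_entry_additive].
Qed.

Lemma rip_delta (u : 'cV[K]_d) i : rip u (delta_mx i 0) = sre (u i 0).
Proof.
rewrite ripE (bigD1 i) //= big1 => [|l li].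
  rewrite !mxE !eqxx -(rmorph1 (@sreal R k)) sre_sreal sim_sreal.
  by rewrite mulr1 mulr0 !addr0.
by rewrite !mxE (negbTE li) !raddf0 !mulr0 addr0.
Qed.

(** The test vector is the imaginary unit times e_i over C, and 0 over R, where both sides
    vanish. *)
Lemma rip_idelta (u : 'cV[K]_d) i : rip u (smk 0 1 *: delta_mx i 0) = sim (u i 0).
Proof.
rewrite ripE (bigD1 i) //= big1 => [|l li].
  rewrite !mxE !eqxx mulr1 sre_smk mulr0 add0r addr0.
  by move: (u i 0); case: k => [x|x] /=; rewrite ?mulr1 ?mulr0.
by rewrite !mxE (negbTE li) mulr0 !raddf0 !mulr0 addr0.
Qed.

Lemma sre_rip_delta (M : 'M[K]_d) i j : sre (M i j) = rip (M *m delta_mx j 0) (delta_mx i 0).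
Proof. by rewrite rip_delta -colE mxE. Qed.

Lemma sim_rip_delta (M : 'M[K]_d) i j :
  sim (M i j) = rip (M *m delta_mx j 0) (smk 0 1 *: delta_mx i 0).
Proof. by rewrite rip_idelta -colE mxE. Qed.

Lemma psdmx_diag_ge0 (M : 'M[K]_d) i : psdmx M -> 0 <= sre (M i i).
Proof. by move=> /psdmxP[_ M0]; rewrite sre_rip_delta. Qed.

Lemma psdmx_diag_le_tr (M : 'M[K]_d) i : psdmx M -> sre (M i i) <= sre (\tr M).
Proof.
move=> M0; rewrite /mxtrace raddf_sum /= (bigD1 i) //= lerDl.
by apply: sumr_ge0 => j _; exact: psdmx_diag_ge0.
Qed.

Lemma psdmx_rip_le (M : 'M[K]_d) (x y : 'cV[K]_d) : psdmx M ->
  2 * `|rip (M *m x) y| <= rip (M *m x) x + rip (M *m y) y.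
Proof.
move=> /psdmxP[MM M0].
have h1 := M0 (x + y); have h2 := M0 (x - y).
have MC : rip (M *m y) x = rip (M *m x) y by rewrite rip_adj MM ripC.
move: h1 h2; rewrite mulmxBr mulmxDr !ripDl !ripDr !ripNl !ripNr MC.
by case: (ger0P (rip (M *m x) y)) => ? ? ?; lra.
Qed.

(** The modulus is at most the mean of two diagonal entries, each at most the trace; imaginary parts
    are reached with the vector of [rip_idelta]. This domination makes the entries of W absolutely
    continuous with respect to the trace measure. *)
Lemma psdmx_entry_le_tr (M : 'M[K]_d) i j : psdmx M ->
  `|sre (M i j)| <= sre (\tr M) /\ `|sim (M i j)| <= sre (\tr M).
Proof.
move=> M0; have ti := psdmx_diag_le_tr i M0; have tj := psdmx_diag_le_tr j M0.
split.
  have := psdmx_rip_le (delta_mx j 0) (delta_mx i 0) M0.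
  by rewrite -!sre_rip_delta; lra.
have := psdmx_rip_le (delta_mx j 0) (smk 0 1 *: delta_mx i 0) M0.
rewrite -sim_rip_delta -sre_rip_delta.
suff : rip (M *m (smk 0 1 *: delta_mx i 0)) (smk 0 1 *: delta_mx i 0) <= sre (M i i).
  by lra.
have mi := psdmx_diag_ge0 i M0.
rewrite ripE (bigD1 i) //= big1 => [|l li].
  rewrite -scalemxAr -colE !mxE !eqxx mulr1 addr0 sreM simM sre_smk.
  by move: (M i i) mi; case: k => [x|x] /= h; rewrite ?mulr0 ?mul0r ?mul1r ?addr0 ?add0r ?subr0 ?mulr1.
by rewrite !mxE (negbTE li) mulr0 !raddf0 !mulr0 addr0.
Qed.

Lemma trW_ge0 E : lm E -> 0 <= trW E.
Proof.
move=> lmE; rewrite trWE; apply: sumr_ge0 => i _.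
exact: psdmx_diag_ge0 (mxm_psd W lmE).
Qed.

Lemma trW_le E G : lm E -> lm G -> G `<=` E -> trW G <= trW E.
Proof.
move=> lmE lmG GE; rewrite (local_additiveD trW_additive lmE lmG GE) lerDl.
by apply: trW_ge0; exact: lm_setD.
Qed.

Local Notation mu := (trace_measure W).

Lemma trace_measure_lm E : lm E -> mu E = (trW E)%:E.
Proof.
move=> lmE; apply/eqP; rewrite eq_le; apply/andP; split.
  by apply: ge_ereal_sup => _ [G [lmG GE] <-]; rewrite lee_fin; exact: trW_le.
by apply: ereal_sup_ubound; exists E => //; split.
Qed.

Lemma trace_measure_ge E G : lm G -> G `<=` E -> ((trW G)%:E <= mu E)%E.
Proof. by move=> lmG GE; apply: ereal_sup_ubound; exists G => //; split. Qed.

Lemma trace_measure0 : mu set0 = 0%E.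
Proof.
rewrite trace_measure_lm; last exact: lm_set0.
by rewrite (local_additive0 trW_additive).
Qed.

Lemma trace_measure_ge0 E : (0 <= mu E)%E.
Proof.
rewrite -[0%E]/(0%:E) -(local_additive0 trW_additive).
apply: trace_measure_ge; [exact: lm_set0|exact: sub0set].
Qed.

Lemma trace_measure_le E G : E `<=` G -> (mu E <= mu G)%E.
Proof.
move=> EG; apply: ge_ereal_sup => _ [H [lmH HE] <-].
by apply: trace_measure_ge => //; exact: subset_trans EG.
Qed.

Lemma trace_measure_superadditive E G : E `&` G = set0 -> (mu E + mu G <= mu (E `|` G))%E.
Proof.
move=> EG; have := trace_measure_ge0 (E `|` G).
case muEG : (mu (E `|` G)) => [c| |] //; last by move=> _; rewrite leey.
move=> c0.
have fin H : H `<=` E `|` G -> mu H \is a fin_num.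
  move=> HEG; rewrite ge0_fin_numE ?trace_measure_ge0 //.
  by rewrite (le_lt_trans (trace_measure_le HEG)) // muEG ltry.
have finE := fin E (@subsetUl _ _ _); have finG := fin G (@subsetUr _ _ _).
rewrite -leeBrDr //; apply: ge_ereal_sup => _ [H [lmH HE] <-].
rewrite leeBrDr // addeC -leeBrDr //; apply: ge_ereal_sup => _ [L [lmL LG] <-].
rewrite leeBrDr // -EFinD addrC -/(trW H) -/(trW L).
rewrite -(local_additiveU trW_additive) //.
  by rewrite -muEG; apply: trace_measure_ge; [exact: lm_setU|exact: setUSS].
by rewrite -subset0 -EG; exact: setISS.
Qed.

(** One inequality is finite superadditivity, since local subsets of disjoint sets unite to a local
    subset of the union. For the other, a local subset G of the union is cut into its intersections
    with the E_n, on which [trW] is countably additive. *)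
Lemma trace_measure_sigma_additive : semi_sigma_additive mu.
Proof.
move=> E mE tE mUE.
have cv : cvgn (fun n => (\sum_(0 <= i < n) mu (E i))%E).
  by apply: is_cvg_nneseries => n _ _; exact: trace_measure_ge0.
suff -> : mu (\bigcup_n E n) = (\big[+%E/0]_(0 <= i <oo) mu (E i))%E by exact: cv.
apply/eqP; rewrite eq_le; apply/andP; split; last first.
  apply: lime_le => //; apply: nearW => n.
  suff h : (\sum_(0 <= i < n) mu (E i) <= mu (\big[setU/set0]_(i < n) E i))%E.
    by apply: (le_trans h); apply: trace_measure_le; exact: bigsetU_bigcup.
  elim: n => [|n IH]; first by rewrite big_nil trace_measure_ge0.
  rewrite big_nat_recr //= big_ord_recr /=.
  rewrite (le_trans (leeD2r _ IH)) // trace_measure_superadditive //.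
  rewrite -bigcup_mkord -subset0 => x [[i /= ni Ei] En].
  by have := tE i n I I (ex_intro _ x (conj Ei En)); lia.
apply: ge_ereal_sup => _ [G [lmG GE] <-]; rewrite -/(trW G).
have lmGE n : lm (G `&` E n) by exact: lm_setI.
have GUE : G = \bigcup_n (G `&` E n) by rewrite -setI_bigcupr; apply/esym/setIidl.
have tGE : trivIset setT (fun n => G `&` E n) by exact: trivIset_setIl.
have lmUGE : lm (\bigcup_n (G `&` E n)) by rewrite -GUE.
have := trW_additive lmGE tGE lmUGE; rewrite -GUE => trG.
have {}trG : (\sum_(0 <= m < n) trW (G `&` E m))%:E @[n --> \oo] --> (trW G)%:E.
  by apply: cvg_EFin => //; exact: nearW.
rewrite -(cvg_lim _ trG) //; apply: lime_le; first by apply/cvg_ex; exists (trW G)%:E.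
apply: nearW => n.
apply: (le_trans _ (nneseries_lim_ge n (fun i _ _ => trace_measure_ge0 (E i)))).
rewrite -sumEFin; apply: lee_sum => i _.
by apply: trace_measure_ge; [exact: lm_setI|exact: subIsetr].
Qed.

HB.instance Definition _ := isMeasure.Build disp X R (trace_measure W)
  trace_measure0 trace_measure_ge0 trace_measure_sigma_additive.

Lemma trace_measure_sigma_finite : sigma_finite setT mu.
Proof.
have [G [lmG tG UG]] := local_partition F.
have mG n : measurable (G n) by exact: lm_measurable (lmG n).
(* Index 0 takes the complement of all atoms; its only local subset is empty, so its measure, a
   supremum over local subsets, is 0. *)
exists (fun n => if n is m.+1 then G m else ~` \bigcup_m G m).
  apply/esym/seteqP; split=> // x _.
  have [[n _ Gx]|nGx] := pselect ((\bigcup_m G m) x); first by exists n.+1.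
  by exists 0%N.
case=> [|n]; last by rewrite trace_measure_lm // ltry.
split; first by apply: measurableC; exact: bigcup_measurable.
rewrite (@le_lt_trans _ _ 0%E) ?ltry //; apply: ge_ereal_sup => _ [H [lmH HG] <-].
rewrite -/(trW H) (_ : H = set0) ?(local_additive0 trW_additive) //.
rewrite -subset0 => x Hx; apply: (HG x Hx); rewrite -UG.
exact: lm_sub_atoms Hx.
Qed.

HB.instance Definition _ := Measure_isSigmaFinite.Build disp X R (trace_measure W)
  trace_measure_sigma_finite.

End trace_measure_theory.

(** * Radon-Nikodym derivatives with respect to the trace measure *)

Section radon_nikodym_piece.
Context {R : realType} {k : scalar_kind} {disp : measure_display}
  {X : measurableType disp} {sigma : set X -> \bar R}
  {F : atomic_filtration sigma} {d : nat}.
Variable W : matrix_measure k F d.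
Local Notation lm := (local_measurable F).
Local Notation mu := (trace_measure W).
Variable w : set X -> R.
Hypothesis w_add : local_additive F w.
Hypothesis w_le : forall E, lm E -> `|w E| <= trW W E.
Variable G : set X.
Hypothesis lmG : lm G.

(** Cutting by the local set G extends w, which is meaningful on local sets only, to a finite charge
    on all measurable sets. *)
Definition local_charge (E : set X) : \bar R := (w (G `&` E))%:E.

Let local_charge0 : local_charge set0 = 0%E.
Proof. by rewrite /local_charge setI0 (local_additive0 w_add). Qed.

Let local_charge_fin E : measurable E -> local_charge E \is a fin_num.
Proof. by []. Qed.

Let local_charge_sigma_additive : semi_sigma_additive local_charge.
Proof.
move=> E mE tE mUE; rewrite /local_charge.
have lmGE n : lm (G `&` E n) by exact: lm_setI.
have -> : G `&` \bigcup_n E n = \bigcup_n (G `&` E n) by rewrite setI_bigcupr.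
under eq_fun do rewrite sumEFin.
apply: cvg_EFin; first exact: nearW.
apply: w_add => //; first exact: trivIset_setIl.
by rewrite -setI_bigcupr; exact: lm_setI.
Qed.

HB.instance Definition _ := isCharge.Build disp X R local_charge
  local_charge0 local_charge_fin local_charge_sigma_additive.

Let local_charge_dominated : local_charge `<< mu.
Proof.
move=> N muN E mE EN; rewrite /local_charge.
have lmGE : lm (G `&` E) by exact: lm_setI.
have : mu (G `&` E) = 0%E.
  apply: muN; first exact: lm_measurable lmGE.
  by apply: subset_trans EN; exact: subIsetr.
rewrite trace_measure_lm // => -[tr0].
by have := w_le lmGE; rewrite tr0 normr_le0 => /eqP ->.
Qed.

Lemma local_density_piece : exists h : X -> R,
  [/\ measurable_fun setT h, mu.-integrable setT (EFin \o h) &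
    forall E, measurable E -> (w (G `&` E))%:E = (\int[mu]_(x in E) (h x)%:E)%E].
Proof.
pose g := Radon_Nikodym local_charge mu.
have g_fin x : g x \is a fin_num by exact: Radon_Nikodym_fin_num local_charge_dominated.
have g_int : mu.-integrable setT g by exact: Radon_Nikodym_integrable local_charge_dominated.
have gE : EFin \o (fine \o g) = g by apply/funext => x /=; rewrite fineK.
exists (fine \o g); split.
- apply/measurable_EFinP; rewrite gE; exact: measurable_int g_int.
- by rewrite gE.
- move=> E mE; rewrite -/(local_charge E) (Radon_Nikodym_integral local_charge_dominated mE).
  by apply: eq_integral => x _; rewrite fineK.
Qed.

End radon_nikodym_piece.

Section density_existence.
Context {R : realType} {k : scalar_kind} {disp : measure_display}
  {X : measurableType disp} {sigma : set X -> \bar R}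
  {F : atomic_filtration sigma} {d : nat}.
Variable W : matrix_measure k F d.
Local Notation K := (base_field R k).
Local Notation lm := (local_measurable F).
Local Notation mu := (trace_measure W).

(** The densities on the pieces of [local_partition] are glued. A local set may meet infinitely many
    pieces, so integrability on it is derived from |w| <= tr W, which bounds the integral of |h|
    over E by the trace measure of E. *)
Lemma local_density (w : set X -> R) : local_additive F w ->
  (forall E, lm E -> `|w E| <= trW W E) ->
  exists h : X -> R, measurable_fun setT h /\
    forall E, lm E -> mu.-integrable E (EFin \o h) /\
      w E = fine (\int[mu]_(x in E) (h x)%:E)%E.
Proof.
move=> w_add w_le; have [G [lmG tG UG]] := local_partition F.
have mG n : measurable (G n) by exact: lm_measurable (lmG n).
have [g gP] := choice (fun n => local_density_piece w_add w_le (lmG n)).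
have mUG : measurable (\bigcup_n G n) by exact: bigcup_measurable.
pose piece x := if pselect (exists n, G n x) is left e then projT1 (cid e) else 0%N.
have pieceP n x : G n x -> piece x = n.
  move=> Gx; rewrite /piece; case: pselect => [e|[]]; last by exists n.
  by case: cid => m /= Gmx; apply: (tG m n) => //; exists x.
pose h x := if x \in \bigcup_n G n then g (piece x) x else 0.
have hE n x : G n x -> h x = g n x.
  move=> Gx; rewrite /h mem_set ?(pieceP n) //; by exists n.
have mh : measurable_fun setT h.
  rewrite -(setUv (\bigcup_n G n)); apply/measurable_funU => //; first exact: measurableC.
  split.
    apply/measurable_fun_bigcup => // n.
    apply: (eq_measurable_fun (g n)) => [x|]; first by rewrite inE => /hE ->.
    by apply: measurable_funTS; have [] := gP n.
  apply: (eq_measurable_fun (fun=> 0 : R)) => [x|]; last exact: measurable_cst.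
  by rewrite inE => nGx; rewrite /h memNset.
exists h; split => // E lmE; have mE := lm_measurable lmE.
have EG : E = \bigcup_n (G n `&` E).
  rewrite -setI_bigcupl -UG; apply/esym/setIidr; exact: lm_sub_atoms lmE.
have tGE : trivIset setT (fun n => G n `&` E) by exact: trivIset_setIr.
have mGE n : measurable (G n `&` E) by exact: measurableI.
have lmGE n : lm (G n `&` E) by exact: lm_setI.
have wE n H : measurable H -> H `<=` G n ->
    (w H)%:E = (\int[mu]_(x in H) (h x)%:E)%E.
  move=> mH HG; have [_ _ gH] := gP n.
  rewrite -[in LHS](setIidr HG) gH //; apply: eq_integral => x.
  by rewrite inE => /HG /hE ->.
have h_int : mu.-integrable E (EFin \o h).
  apply/integrableP; split; first by apply/measurable_EFinP; exact: measurable_funTS.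
  have mhE : measurable_fun E (fun x => `|(h x)%:E|)%E.
    by apply: measurableT_comp => //; apply/measurable_EFinP; exact: measurable_funTS.
  rewrite (@le_lt_trans _ _ (mu E)) //; last by rewrite trace_measure_lm // ltry.
  rewrite [in leLHS]EG ge0_integral_bigcup //; last by rewrite -EG.
  rewrite [in leRHS]EG measure_semi_bigcup //; last by rewrite -EG.
  apply: lee_nneseries => [n _ _|n _]; first exact: integral_ge0.
  (* On the parts where h has constant sign the integral of |h| is w or -w of the part, hence at
     most its trace measure. *)
  pose P := [set x | 0 <= h x].
  have mP : measurable P.
    by rewrite -[P]setTI; exact: measurable_fun_le.
  have mNP : measurable (~` P) by exact: measurableC.
  set D := G n `&` E; have mD : measurable D by exact: mGE.
  have DG : D `<=` G n by exact: subIsetl.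
  have lm_sub H : measurable H -> H `<=` D -> lm H.
    by move=> mH HD; exact: lm_subset (lmGE n) mH HD.
  have mDP : measurable (D `&` P) by exact: measurableI.
  have mDNP : measurable (D `\` P) by exact: measurableD.
  rewrite -[D](setUIDK D P) ge0_integral_setU //=; last 2 first.
  - by apply/measurable_EFinP; apply: measurable_funTS; apply: measurableT_comp.
  - by apply/disj_setPS; rewrite setIDA => x [[[_ Px] _]].
  rewrite measureU //; last by rewrite setIDA -subset0 => x [[[_ Px] _]].
  apply: leeD.
    have -> : (\int[mu]_(x in D `&` P) `|h x|%:E = (w (D `&` P))%:E)%E.
      rewrite (wE n) //; last by apply: subset_trans DG; exact: subIsetl.
      by apply: eq_integral => x; rewrite inE => -[_ Px]; rewrite ger0_norm.
    rewrite [leRHS]trace_measure_lm ?lee_fin; last by apply: lm_sub => //; exact: subIsetl.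
    by apply: (le_trans (ler_norm _)); apply: w_le; apply: lm_sub => //; exact: subIsetl.
  have -> : (\int[mu]_(x in D `\` P) `|h x|%:E = - (w (D `\` P))%:E)%E.
    have DPG : D `\` P `<=` G n by apply: subset_trans DG; exact: subDsetl.
    rewrite (wE n) // -integralN.
      apply: eq_integral => x; rewrite inE => -[_ /negP Px].
      by rewrite ltr0_norm // ltNge.
    apply: integrable_add_def => //; have [_ g_int _] := gP n.
    apply: (eq_integrable _ (EFin \o g n)) => // [x|].
      by rewrite inE /= => /DPG /hE ->.
    exact: integrableS g_int.
  rewrite [leRHS]trace_measure_lm ?lee_fin; last by apply: lm_sub => //; exact: subDsetl.
  rewrite (le_trans (ler_norm _)) // normrN.
  by apply: w_le; apply: lm_sub => //; exact: subDsetl.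
split => //.
have wsum : \sum_(0 <= m < n) w (G m `&` E) @[n --> \oo] --> w E.
  by rewrite [X in _ --> w X]EG; apply: w_add => //; rewrite -EG.
have : (\int[mu]_(x in E) (h x)%:E)%E = (w E)%:E; last by move=> ->.
rewrite [in LHS]EG integral_bigcup //; last by rewrite -EG.
apply/cvg_lim => //; 
rewrite (_ : (fun n => _) = (fun n => (\sum_(0 <= m < n) w (G m `&` E))%:E)); last first.
  apply/funext => n; rewrite -sumEFin; apply: eq_bigr => m _.
  by rewrite -(wE m) //; exact: subIsetl.
by apply: cvg_EFin => //; exact: nearW.
Qed.

End density_existence.

Section integral_predicate.
Context {R : realType} {disp : measure_display} {X : measurableType disp}.
Variable mu : {measure set X -> \bar R}.

(** Integrability bundled with a real value of the integral, so that linearity can be applied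
    without side conditions on infinite values. *)
Definition has_int (E : set X) (h : X -> R) (c : R) :=
  mu.-integrable E (EFin \o h) /\ (\int[mu]_(x in E) (h x)%:E = c%:E)%E.

Implicit Types (E G : set X) (h g : X -> R).

Lemma has_int_fine E h : measurable E -> mu.-integrable E (EFin \o h) ->
  has_int E h (fine (\int[mu]_(x in E) (h x)%:E)%E).
Proof. by move=> mE ih; split => //; rewrite fineK //; exact: integrable_fin_num. Qed.

Lemma has_int0 E : has_int E (fun=> 0) 0.
Proof. by split; [exact: integrable0|rewrite integral0]. Qed.

Lemma has_intD E h g a b : measurable E ->
  has_int E h a -> has_int E g b -> has_int E (fun x => h x + g x) (a + b).
Proof.
move=> mE [ih ah] [ig bg]; split; first exact: (integrableD mE ih ig).
by rewrite EFinD -ah -bg -integralD_EFin.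
Qed.

Lemma has_intZ E h a c : measurable E ->
  has_int E h a -> has_int E (fun x => c * h x) (c * a).
Proof.
move=> mE [ih ah]; split; first exact: (integrableZl mE c ih).
by rewrite EFinM -ah -integralZl.
Qed.

Lemma has_int_sum E I (r : seq I) (h : I -> X -> R) (a : I -> R) : measurable E ->
  (forall i, has_int E (h i) (a i)) ->
  has_int E (fun x => \sum_(i <- r) h i x) (\sum_(i <- r) a i).
Proof.
move=> mE ha; elim: r => [|i r IH].
  rewrite big_nil (_ : (fun _ => _) = fun=> 0); first exact: has_int0.
  by apply/funext => x; rewrite big_nil.
rewrite big_cons (_ : (fun _ => _) = fun x => h i x + \sum_(i <- r) h i x).
  exact: has_intD.
by apply/funext => x; rewrite big_cons.
Qed.

Lemma has_int_ge0 E h a : (forall x, 0 <= h x) -> has_int E h a -> 0 <= a.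
Proof.
by move=> h0 [_ ha]; rewrite -lee_fin -ha; apply: integral_ge0 => x _; rewrite lee_fin.
Qed.

Lemma has_int_uniq E h a b : has_int E h a -> has_int E h b -> a = b.
Proof. by move=> [_ ha] [_ hb]; apply: EFin_inj; rewrite -ha -hb. Qed.

Lemma has_int_setD E G h a b c : measurable E -> measurable G -> G `<=` E ->
  has_int E h a -> has_int G h b -> has_int (E `\` G) h c -> a = b + c.
Proof.
move=> mE mG GE [ih ah] [_ bh] [_ ch]; apply: EFin_inj; rewrite EFinD -ah -bh -ch.
rewrite -integral_setU ?setDUK //; [exact: measurableD|exact: measurable_int ih|].
by apply/disj_setPS; rewrite setDIK.
Qed.

End integral_predicate.

Section scalar_functions.
Context {R : realType} {k : scalar_kind} {disp : measure_display}
  {X : measurableType disp}.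
Local Notation K := (base_field R k).

Lemma smk_eta (x : K) : smk (sre x) (sim x) = x.
Proof. by move: x; case: k => [//|[]]. Qed.

Lemma scalar_measurable_smk (h g : X -> R) :
  measurable_fun setT h -> measurable_fun setT g ->
  scalar_measurable (fun x => smk (h x) (g x) : K).
Proof. by move=> mh mg; rewrite /scalar_measurable; case: k; split => //; exact: measurable_cst. Qed.

Lemma scalar_integral_smk (h g : X -> R) (m : set X -> \bar R) E :
  scalar_integral m E (fun x => smk (h x) (g x) : K) =
    smk (fine (\int[m]_(x in E) (h x)%:E)%E) (fine (\int[m]_(x in E) (g x)%:E)%E).
Proof. by rewrite /scalar_integral; case: k. Qed.

Lemma scalar_integrable_smk (m : {measure set X -> \bar R}) (h g : X -> R) E :
  m.-integrable E (EFin \o h) -> m.-integrable E (EFin \o g) ->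
  scalar_integrable m E (fun x => smk (h x) (g x) : K).
Proof. by move=> ih ig; rewrite /scalar_integrable; case: k; split => //; exact: integrable0. Qed.

Lemma sre_scalar_integral (m : set X -> \bar R) E (g : X -> K) :
  sre (scalar_integral m E g) = fine (\int[m]_(x in E) (sre (g x))%:E)%E.
Proof. by rewrite /scalar_integral sre_smk. Qed.

Lemma sim_scalar_integral (m : {measure set X -> \bar R}) E (g : X -> K) :
  sim (scalar_integral m E g) = fine (\int[m]_(x in E) (sim (g x))%:E)%E.
Proof. by move: g; rewrite /scalar_integral; case: k => g //=; rewrite integral0. Qed.

End scalar_functions.

Section density_spec.
Context {R : realType} {k : scalar_kind} {disp : measure_display}
  {X : measurableType disp} {sigma : set X -> \bar R}
  {F : atomic_filtration sigma} {d : nat}.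
Variable W : matrix_measure k F d.
Local Notation K := (base_field R k).
Local Notation lm := (local_measurable F).
Local Notation mu := (trace_measure W).

Lemma density_exists : exists V, is_density W V.
Proof.
have entry_le i j E : lm E -> `|sre (W E i j)| <= trW W E /\ `|sim (W E i j)| <= trW W E.
  by move=> lmE; exact: psdmx_entry_le_tr (mxm_psd W lmE).
have re_ex (ij : 'I_d * 'I_d) := local_density (@sre_entry_additive _ _ _ _ _ _ _ W ij.1 ij.2)
  (fun E lmE => (entry_le ij.1 ij.2 E lmE).1).
have im_ex (ij : 'I_d * 'I_d) := local_density (@sim_entry_additive _ _ _ _ _ _ _ W ij.1 ij.2)
  (fun E lmE => (entry_le ij.1 ij.2 E lmE).2).
have [h hP] := choice re_ex; have [g gP] := choice im_ex.
exists (fun x => \matrix_(i, j) smk (h (i, j) x) (g (i, j) x)) => i j.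
have [mh ih] := hP (i, j); have [mg ig] := gP (i, j).
have -> : (fun x => (\matrix_(i, j) smk (h (i, j) x) (g (i, j) x)) i j) =
  (fun x => smk (h (i, j) x) (g (i, j) x) : K) by apply/funext => x; rewrite mxE.
split; first exact: scalar_measurable_smk.
move=> E lmE; have [ihE whE] := ih E lmE; have [igE wgE] := ig E lmE.
split; first exact: scalar_integrable_smk.
by rewrite scalar_integral_smk -whE -wgE smk_eta.
Qed.

Lemma densityP : is_density W (density W).
Proof.
have [V VW] := density_exists.
by rewrite /density; case: xgetP => [V' -> //|/(_ V)].
Qed.

Lemma is_density_has_int V E : is_density W V -> lm E -> forall i j,
  has_int mu E (fun x => sre (V x i j)) (sre (W E i j)) /\
  has_int mu E (fun x => sim (V x i j)) (sim (W E i j)).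
Proof.
move=> VW lmE i j; have mE := lm_measurable lmE.
have [_ /(_ E lmE)[[ire iim] ->]] := VW i j.
by split; rewrite ?sre_scalar_integral ?sim_scalar_integral; exact: has_int_fine.
Qed.

End density_spec.

(** * Positivity of the density almost everywhere *)

Section rational_test_vectors.
Context {R : realType} {k : scalar_kind} {d : nat}.
Local Notation K := (base_field R k).

Lemma rip_mulmxE (M : 'M[K]_d) u v : rip (M *m u) v =
  \sum_i \sum_j (sre (M i j) * (sre (u j 0) * sre (v i 0) + sim (u j 0) * sim (v i 0)) +
    sim (M i j) * (sre (u j 0) * sim (v i 0) - sim (u j 0) * sre (v i 0))).
Proof.
rewrite ripE; apply: eq_bigr => i _; rewrite mxE !raddf_sum /= !mulr_suml -big_split.
by apply: eq_bigr => j _ /=; rewrite sreM simM; ring.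
Qed.

Lemma rat_sequence (r : R) : exists q : nat -> rat, ratr (q n) @[n --> \oo] --> r.
Proof.
have qE n : exists q : rat, ratr q \in `]r, r + n.+1%:R^-1[.
  by apply: rat_in_itvoo; rewrite ltrDl invr_gt0.
have [q qP] := choice qE; exists q.
apply: (@squeeze_cvgr _ _ _ _ (fun=> r) (fun n => r + harmonic n)).
- by apply: nearW => n; have := qP n; rewrite in_itv /= => /andP[a b]; rewrite !ltW.
- exact: cvg_cst.
- by rewrite -[X in _ --> X]addr0; apply: cvgD; [exact: cvg_cst|exact: cvg_harmonic].
Qed.

Definition rat_vector (q : {ffun 'I_d -> rat * rat}) : 'cV[K]_d :=
  \col_i smk (ratr (q i).1) (ratr (q i).2).

(** The form is continuous and rational vectors are dense. Positivity thus amounts to countably many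
    inequalities, which can hold simultaneously almost everywhere. *)
Lemma psdmx_rat_vector (M : 'M[K]_d) : adjmx M = M ->
  (forall q, 0 <= rip (M *m rat_vector q) (rat_vector q)) -> psdmx M.
Proof.
move=> MM Mq; apply/psdmxP; split => // u.
have [p pP] := choice (fun i => rat_sequence (sre (u i 0))).
have [q qP] := choice (fun i => rat_sequence (sim (u i 0))).
pose v n := rat_vector [ffun i => (p i n, q i n)].
have sim_smk (a b : R) : sim (smk a b : K) = sim (smk 0 1 : K) * b.
  by case: k => /=; rewrite ?mul0r ?mul1r.
have sre_v i : sre (v n i 0) @[n --> \oo] --> sre (u i 0).
  by under eq_fun do rewrite mxE ffunE sre_smk; exact: pP.
have sim_v i : sim (v n i 0) @[n --> \oo] --> sim (u i 0).
  under eq_fun do rewrite mxE ffunE sim_smk.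
  rewrite -(smk_eta (u i 0)) sim_smk; apply: cvgMr => //; exact: qP.
have cv : rip (M *m v n) (v n) @[n --> \oo] --> rip (M *m u) u.
  under eq_fun do rewrite rip_mulmxE.
  rewrite rip_mulmxE; apply: cvg_big => [|i _]; first exact: add_continuous.
  apply: cvg_big => [|j _]; first exact: add_continuous.
  by apply: cvgD; apply: cvgMr => //; [apply: cvgD|apply: cvgB]; exact: cvgM.
rewrite -(cvg_lim (@Rhausdorff R) cv); apply: limr_ge.
  by apply/cvg_ex; exists (rip (M *m u) u).
by apply: nearW => n; exact: Mq.
Qed.

End rational_test_vectors.

Section psd_density.
Context {R : realType} {k : scalar_kind} {disp : measure_display}
  {X : measurableType disp} {sigma : set X -> \bar R}
  {F : atomic_filtration sigma} {d : nat}.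
Variable W : matrix_measure k F d.
Local Notation K := (base_field R k).
Local Notation lm := (local_measurable F).
Local Notation mu := (trace_measure W).

(** The measure of the set h < 0 is a supremum over its local subsets. On such a subset the integral
    of |h| is -c <= 0, so h vanishes there almost everywhere, which leaves only null subsets. *)
Lemma ae_ge0_local (h : X -> R) : measurable_fun setT h ->
  (forall E, lm E -> exists2 c, 0 <= c & has_int mu E h c) ->
  \forall x \ae mu, 0 <= h x.
Proof.
move=> mh h_int; pose N := [set x | h x < 0].
have mN : measurable N.
  rewrite (_ : N = ~` (setT `&` [set x | 0 <= h x])).
    by apply: measurableC; exact: measurable_fun_le.
  by rewrite setTI; apply/funext => x; apply/propext; rewrite /N /= ltNge; split=> /negP.
exists N; split => //; last by move=> x /= /negP; rewrite -ltNge.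
apply/eqP; rewrite eq_le measure_ge0 andbT; apply: ge_ereal_sup => _ [H [lmH HN] <-].
have mH := lm_measurable lmH; rewrite -/(trW W H) -trace_measure_lm //.
have [c c0 [ih hc]] := h_int H lmH.
have abs0 : (\int[mu]_(x in H) `|(h x)%:E|)%E = 0%E.
  apply/eqP; rewrite eq_le integral_ge0 // andbT.
  have -> : (\int[mu]_(x in H) `|(h x)%:E| = - c%:E)%E.
    rewrite -hc -integralN; last exact: integrable_add_def.
    by apply: eq_integral => x; rewrite inE => /HN hx /=; rewrite ltr0_norm.
  by rewrite -EFinN lee_fin oppr_le0.
have [N' [mN' muN' HN']] := (ae_eq_integral_abs mu mH (measurable_int _ ih)).1 abs0.
rewrite -muN'; apply: le_measure; rewrite ?inE // => x Hx.
apply: HN' => /= /(_ Hx) [] hx0; have := HN x Hx.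
by rewrite /N /= hx0 ltxx.
Qed.

Lemma has_int_rip V E u v : is_density W V -> lm E ->
  has_int mu E (fun x => rip (V x *m u) v) (rip (W E *m u) v).
Proof.
move=> VW lmE; have mE := lm_measurable lmE.
rewrite rip_mulmxE (_ : (fun x => _) = (fun x => \sum_i \sum_j
  ((sre (u j 0) * sre (v i 0) + sim (u j 0) * sim (v i 0)) * sre (V x i j) +
   (sre (u j 0) * sim (v i 0) - sim (u j 0) * sre (v i 0)) * sim (V x i j)))); last first.
  apply/funext => x; rewrite rip_mulmxE; apply: eq_bigr => i _; apply: eq_bigr => j _.
  by ring.
apply: has_int_sum => // i; apply: has_int_sum => // j.
rewrite (mulrC (sre (W E i j))) (mulrC (sim (W E i j))).
have [hre him] := is_density_has_int VW lmE i j.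
by apply: has_intD => //; exact: has_intZ.
Qed.

Lemma measurable_sum_fun I (r : seq I) (h : I -> X -> R) :
  (forall i, measurable_fun setT (h i)) ->
  measurable_fun setT (fun x => \sum_(i <- r) h i x).
Proof.
move=> mh; elim: r => [|i r IH].
  by under eq_fun do rewrite big_nil; exact: measurable_cst.
by under eq_fun do rewrite big_cons; exact: measurable_funD.
Qed.

Lemma measurable_rip (V : X -> 'M[K]_d) (f g : X -> 'cV[K]_d) :
  (forall i j, scalar_measurable (fun x => V x i j)) ->
  (forall i, scalar_measurable (fun x => f x i 0)) ->
  (forall i, scalar_measurable (fun x => g x i 0)) ->
  measurable_fun setT (fun x => rip (V x *m f x) (g x)).
Proof.
move=> mV mf mg; under eq_fun do rewrite rip_mulmxE.
apply: measurable_sum_fun => i; apply: measurable_sum_fun => j.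
have [mV1 mV2] := mV i j; have [mf1 mf2] := mf j; have [mg1 mg2] := mg i.
apply: measurable_funD; apply: measurable_funM => //.
  by apply: measurable_funD; exact: measurable_funM.
by apply: measurable_funB; exact: measurable_funM.
Qed.

Lemma scalar_measurable_cst (c : K) : scalar_measurable (fun _ : X => c).
Proof. by split; exact: measurable_cst. Qed.

(** Each requirement is an inequality whose integrals over local sets are known from W: Hermitian
    symmetry is a pair of opposite inequalities for each entry, and positivity is tested on rational
    vectors. *)
Lemma density_ae_psd : \forall x \ae mu, psdmx (density W x).
Proof.
have VW := densityP W; set V := density W in VW *.
have mV i j : scalar_measurable (fun x => V x i j) by have [] := VW i j.
have herm E i j : lm E -> sre (W E i j) = sre (W E j i) /\ sim (W E i j) = - sim (W E j i).
  move=> lmE; have /psdmxP[WW _] := mxm_psd W lmE.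
  by split; rewrite -[in LHS]WW !mxE ?sre_conj ?sim_conj.
have V_re : \forall x \ae mu, forall ij : 'I_d * 'I_d,
    0 <= sre (V x ij.1 ij.2) - sre (V x ij.2 ij.1).
  apply: filter_forall => -[i j] /=; apply: ae_ge0_local.
    by apply: measurable_funB; [have [] := mV i j|have [] := mV j i].
  move=> E lmE; exists 0 => //; have mE := lm_measurable lmE.
  have [hij _] := is_density_has_int VW lmE i j.
  have [hji _] := is_density_has_int VW lmE j i.
  have := has_intD mE hij (has_intZ (-1) mE hji).
  rewrite mulN1r (herm E i j lmE).1 subrr.
  by under [X in has_int _ _ X _]eq_fun do rewrite mulN1r.
have V_im : \forall x \ae mu, forall ij : 'I_d * 'I_d,
    0 <= sim (V x ij.1 ij.2) + sim (V x ij.2 ij.1).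
  apply: filter_forall => -[i j] /=; apply: ae_ge0_local.
    by apply: measurable_funD; [have [] := mV i j|have [] := mV j i].
  move=> E lmE; exists 0 => //; have mE := lm_measurable lmE.
  have [_ hij] := is_density_has_int VW lmE i j.
  have [_ hji] := is_density_has_int VW lmE j i.
  have := has_intD mE hij hji.
  by rewrite (herm E i j lmE).2 addNr.
have V_im' : \forall x \ae mu, forall ij : 'I_d * 'I_d,
    0 <= - (sim (V x ij.1 ij.2) + sim (V x ij.2 ij.1)).
  apply: filter_forall => -[i j] /=; apply: ae_ge0_local.
    by apply: measurableT_comp => //; apply: measurable_funD; [have [] := mV i j|have [] := mV j i].
  move=> E lmE; exists 0 => //; have mE := lm_measurable lmE.
  have [_ hij] := is_density_has_int VW lmE i j.
  have [_ hji] := is_density_has_int VW lmE j i.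
  have := has_intZ (-1) mE (has_intD mE hij hji).
  rewrite (herm E i j lmE).2 addNr mulr0.
  by under [X in has_int _ _ X _]eq_fun do rewrite mulN1r.
(* Rational vectors are indexed by their integer codes, to intersect countably many sets of full
   measure; numbers that code nothing carry no condition. *)
have V_q : \forall x \ae mu, forall n : nat,
    if @choice.unpickle {ffun 'I_d -> rat * rat} n is Some q
    then 0 <= rip (V x *m rat_vector q) (rat_vector q) else true.
  apply: ae_foralln => n; case: choice.unpickle => [q|]; last exact: nearW.
  apply: ae_ge0_local.
    by apply: measurable_rip => // i; exact: scalar_measurable_cst.
  move=> E lmE; exists (rip (W E *m rat_vector q) (rat_vector q)).
    by have /psdmxP[_] := mxm_psd W lmE.
  exact: has_int_rip.
apply: filterS (filterI (filterI V_re V_im) (filterI V_im' V_q)).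
move=> x [[Vre Vim] [Vim' Vq]]; apply: psdmx_rat_vector => [|q].
  apply/matrixP => i j; rewrite !mxE; apply: scalar_ext; rewrite ?sre_conj ?sim_conj.
    by have := Vre (i, j); have := Vre (j, i); rewrite /=; lra.
  by have := Vim (i, j); have := Vim' (i, j); rewrite /=; lra.
by have := Vq (choice.pickle q); rewrite choice.pickleK.
Qed.

(** Setting the density to 0 on a null set makes positivity hold at every point, so that the
    pointwise inequalities below need no exceptional set. *)
Lemma psd_density : exists V : X -> 'M[K]_d,
  [/\ forall x, psdmx (V x), is_density W V & \forall x \ae mu, density W x = V x].
Proof.
have [N [mN muN NV]] := density_ae_psd.
have VW := densityP W.
pose V x := if x \in N then 0 else density W x.
have V_ae : \forall x \ae mu, density W x = V x.
  exists N; split => // x; rewrite /V /=; case: ifPn => [/set_mem //|_ []].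
  by [].
have Vij i j (f : {additive K -> R}) : measurable_fun setT (fun x => f (density W x i j)) ->
    measurable_fun setT (fun x => f (V x i j)).
  move=> mf; rewrite (_ : (fun x => _) = (fun x => if x \in N then 0 else f (density W x i j))).
    apply: measurable_fun_ifT => //; apply: (measurable_fun_bool true).
    rewrite setTI (_ : _ @^-1` _ = N) //.
    by apply/seteqP; split=> x /=; [exact: set_mem|exact: mem_set].
  by apply/funext => x; rewrite /V; case: ifP => //; rewrite mxE raddf0.
exists V; split => //.
  move=> x; rewrite /V; case: ifPn => [_|xN]; first exact: psdmx0.
  by apply: contrapT => /NV xN'; move/negP: xN; apply; exact: mem_set.
move=> i j; have [[mre mim] VWE] := VW i j.
have mVre : measurable_fun setT (fun x => sre (V x i j)) := Vij i j (@sre R k) mre.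
have mVim : measurable_fun setT (fun x => sim (V x i j)) := Vij i j (@sim R k) mim.
split; first by split.
move=> E lmE; have [[ire iim] ->] := VWE E lmE; have mE := lm_measurable lmE.
have mTS (h : X -> R) : measurable_fun setT h -> measurable_fun E (EFin \o h).
  by move=> mh; apply/measurable_EFinP; exact: measurable_funTS.
have V_le (f : {additive K -> R}) x : `|f (V x i j)| <= `|f (density W x i j)|.
  by rewrite /V; case: ifP => // _; rewrite mxE raddf0 normr0.
have V_int (f : {additive K -> R}) : measurable_fun setT (fun x => f (V x i j)) ->
    mu.-integrable E (fun x => (f (density W x i j))%:E) ->
    mu.-integrable E (fun x => (f (V x i j))%:E).
  move=> mf; apply: le_integrable => //; first exact: mTS.
  by move=> x _; rewrite !abse_EFin lee_fin V_le.
have V_eq (f : {additive K -> R}) : measurable_fun setT (fun x => f (V x i j)) ->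
    measurable_fun setT (fun x => f (density W x i j)) ->
    (\int[mu]_(x in E) (f (density W x i j))%:E = \int[mu]_(x in E) (f (V x i j))%:E)%E.
  move=> mVf mf; apply: ae_eq_integral => //; [exact: mTS|exact: mTS|].
  by apply: filterS V_ae => x /= ->.
split; first by split; [exact: (V_int (@sre R k))|exact: (V_int (@sim R k))].
by rewrite /scalar_integral (V_eq (@sre R k)) // (V_eq (@sim R k)).
Qed.

End psd_density.

(** * Integrals against the matrix measure *)

Section square_norm.
Context {R : realType} {k : scalar_kind} {disp : measure_display}
  {X : measurableType disp} {sigma : set X -> \bar R}
  {F : atomic_filtration sigma} {d : nat}.
Variable W : matrix_measure k F d.
Local Notation K := (base_field R k).
Local Notation lm := (local_measurable F).
Local Notation mu := (trace_measure W).
Variable V : X -> 'M[K]_d.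
Hypothesis V_psd : forall x, psdmx (V x).
Hypothesis VW : is_density W V.
Hypothesis V_ae : \forall x \ae mu, density W x = V x.

Let mV i j : scalar_measurable (fun x => V x i j). Proof. by have [] := VW i j. Qed.

Let mD i j : scalar_measurable (fun x => density W x i j).
Proof. by have [] := densityP W i j. Qed.

Variable f : X -> 'cV[K]_d.
Hypothesis mf : forall i, scalar_measurable (fun x => f x i 0).

Let q x := rip (V x *m f x) (f x).

Let q_ge0 x : 0 <= q x. Proof. by have /psdmxP[_ /(_ (f x))] := V_psd x. Qed.

Let mq : measurable_fun setT q. Proof. exact: measurable_rip. Qed.

Lemma sqnorm_L2E : sqnorm_L2 W f = (\int[mu]_x (q x)%:E)%E.
Proof.
rewrite /sqnorm_L2; apply: ae_eq_integral => //.
- by apply/measurable_EFinP; exact: (measurable_rip mD mf mf).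
- exact/measurable_EFinP.
- by apply: filterS V_ae => x /= ->.
Qed.

Lemma sqnorm_L2_ge0 : (0 <= sqnorm_L2 W f)%E.
Proof. by rewrite sqnorm_L2E; apply: integral_ge0 => x _; rewrite lee_fin. Qed.

Hypothesis f_fin : (sqnorm_L2 W f < +oo)%E.

Lemma energy_integrable : mu.-integrable setT (EFin \o q).
Proof.
apply/integrableP; split; first exact/measurable_EFinP.
rewrite (_ : (\int[mu]_x `|(EFin \o q) x|)%E = sqnorm_L2 W f) // sqnorm_L2E.
by apply: eq_integral => x _ /=; rewrite ger0_norm.
Qed.

Definition energy_on (E : set X) : R := fine (\int[mu]_(x in E) (q x)%:E)%E.

Lemma energy_on_has_int E : lm E -> has_int mu E q (energy_on E).
Proof.
move=> lmE; have mE := lm_measurable lmE; apply: has_int_fine => //.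
exact: integrableS energy_integrable.
Qed.

Lemma energy_on_le E : lm E -> ((energy_on E)%:E <= sqnorm_L2 W f)%E.
Proof.
move=> lmE; have [_ <-] := energy_on_has_int lmE; rewrite sqnorm_L2E.
apply: ge0_subset_integral => //; [exact: lm_measurable lmE|exact/measurable_EFinP|].
by move=> x _; rewrite lee_fin.
Qed.

(** Positivity of V gives 2 |<V f, u>| <= <V f, f> + <V u, u>; the first term is integrable because
    f is in L^2(W), the second because W is finite on local sets. *)
Lemma rip_integrable E u : lm E ->
  mu.-integrable E (fun x => (rip (V x *m f x) u)%:E).
Proof.
move=> lmE; have mE := lm_measurable lmE.
have [iq _] := energy_on_has_int lmE; have [iu _] := has_int_rip u u VW lmE.
apply: (le_integrable mE _ _ (integrableD mE iq iu)).
  apply/measurable_EFinP; apply: measurable_funTS; apply: measurable_rip => // i.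
  exact: scalar_measurable_cst.
move=> x _ /=; rewrite lee_fin.
have u0 : 0 <= rip (V x *m u) u by have /psdmxP[_] := V_psd x.
rewrite (ger0_norm (addr_ge0 (q_ge0 x) u0)).
by have := psdmx_rip_le (f x) u (V_psd x); rewrite -/(q x); have := normr_ge0 (rip (V x *m f x) u); lra.
Qed.

(** Both parts of an entry are values of [rip] at fixed vectors, so one comparison of [density W]
    with V outside a null set covers them. *)
Lemma mxm_integral_entry E i : lm E ->
  sre (mxm_integral W E f i 0) = fine (\int[mu]_(x in E) (sre ((V x *m f x) i 0))%:E)%E /\
  sim (mxm_integral W E f i 0) = fine (\int[mu]_(x in E) (sim ((V x *m f x) i 0))%:E)%E.
Proof.
move=> lmE; have mE := lm_measurable lmE.
have meas (U : X -> 'M[K]_d) u : (forall i j, scalar_measurable (fun x => U x i j)) ->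
    measurable_fun E (fun x => (rip (U x *m f x) u)%:E).
  move=> mU; apply/measurable_EFinP; apply: measurable_funTS; apply: measurable_rip => // j.
  exact: scalar_measurable_cst.
have eq_int u : (\int[mu]_(x in E) (rip (density W x *m f x) u)%:E =
    \int[mu]_(x in E) (rip (V x *m f x) u)%:E)%E.
  apply: ae_eq_integral => //; [exact: meas|exact: meas|].
  by apply: filterS V_ae => x /= ->.
rewrite !mxE sre_scalar_integral sim_scalar_integral; split; congr fine.
  transitivity (\int[mu]_(x in E) (rip (density W x *m f x) (delta_mx i 0))%:E)%E.
    by apply: eq_integral => x _; rewrite rip_delta.
  by rewrite eq_int; apply: eq_integral => x _; rewrite rip_delta.
pose e : 'cV[K]_d := smk 0 1 *: delta_mx i 0.
transitivity (\int[mu]_(x in E) (rip (density W x *m f x) e)%:E)%E.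
  by apply: eq_integral => x _; rewrite rip_idelta.
by rewrite eq_int; apply: eq_integral => x _; rewrite rip_idelta.
Qed.

Lemma mxm_integral_has_int E u : lm E ->
  has_int mu E (fun x => rip (V x *m f x) u) (rip (mxm_integral W E f) u).
Proof.
move=> lmE; have mE := lm_measurable lmE.
rewrite ripE (_ : (fun x => _) = (fun x => \sum_i
    (sre (u i 0) * sre ((V x *m f x) i 0) + sim (u i 0) * sim ((V x *m f x) i 0)))); last first.
  by apply/funext => x; rewrite ripE; apply: eq_bigr => i _; rewrite mulrC [X in _ + X]mulrC.
apply: has_int_sum => // i.
have [re_i im_i] := mxm_integral_entry i lmE.
rewrite (mulrC (sre (mxm_integral _ _ _ _ _))) (mulrC (sim (mxm_integral _ _ _ _ _))).
have has_re : has_int mu E (fun x => sre ((V x *m f x) i 0)) (sre (mxm_integral W E f i 0)).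
  rewrite re_i; apply: has_int_fine => //.
  by have := rip_integrable (delta_mx i 0) lmE; apply: eq_integrable => // x _; rewrite rip_delta.
have has_im : has_int mu E (fun x => sim ((V x *m f x) i 0)) (sim (mxm_integral W E f i 0)).
  rewrite im_i; apply: has_int_fine => //.
  have := rip_integrable (smk 0 1 *: delta_mx i 0) lmE.
  by apply: eq_integrable => // x _; rewrite rip_idelta.
by apply: has_intD => //; exact: has_intZ.
Qed.

(** Integrate <V (f - u), f - u> >= 0 over E. *)
Lemma energy_ineq E u : lm E ->
  2 * rip (mxm_integral W E f) u - rip (W E *m u) u <= energy_on E.
Proof.
move=> lmE; have mE := lm_measurable lmE.
have hq := energy_on_has_int lmE; have hf := mxm_integral_has_int u lmE.
have hu := has_int_rip u u VW lmE.
have := has_intD mE (has_intD mE hq (has_intZ (- 2) mE hf)) hu.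
move=> /has_int_ge0 h0; suff : 0 <= energy_on E + - 2 * rip (mxm_integral W E f) u + rip (W E *m u) u by lra.
apply: h0 => x; have /psdmxP[VV /(_ (f x - u))] := V_psd x.
rewrite mulmxBr !ripDl !ripDr !ripNl !ripNr.
have -> : rip (V x *m u) (f x) = rip (V x *m f x) u by rewrite rip_adj VV ripC.
by rewrite -/(q x); lra.
Qed.

Lemma rip_ext (u v : 'cV[K]_d) : (forall w, rip u w = rip v w) -> u = v.
Proof.
move=> uv; apply/eqP; rewrite -subr_eq0; apply/eqP/rip_eq0.
by rewrite ripDl ripNl uv subrr.
Qed.

Lemma mxm_integral_setD E G : lm E -> lm G -> G `<=` E ->
  mxm_integral W E f = mxm_integral W G f + mxm_integral W (E `\` G) f.
Proof.
move=> lmE lmG GE; apply: rip_ext => u; rewrite ripDl.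
have lmEG : lm (E `\` G) by exact: lm_setD.
exact: has_int_setD (lm_measurable lmE) (lm_measurable lmG) GE
  (mxm_integral_has_int u lmE) (mxm_integral_has_int u lmG) (mxm_integral_has_int u lmEG).
Qed.

Lemma energy_on_setD E G : lm E -> lm G -> G `<=` E ->
  energy_on E = energy_on G + energy_on (E `\` G).
Proof.
move=> lmE lmG GE; have lmEG : lm (E `\` G) by exact: lm_setD.
exact: has_int_setD (lm_measurable lmE) (lm_measurable lmG) GE
  (energy_on_has_int lmE) (energy_on_has_int lmG) (energy_on_has_int lmEG).
Qed.

End square_norm.

Section matrix_measure_algebra.
Context {R : realType} {k : scalar_kind} {disp : measure_display}
  {X : measurableType disp} {sigma : set X -> \bar R}
  {F : atomic_filtration sigma} {d : nat}.
Variable W : matrix_measure k F d.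
Local Notation K := (base_field R k).
Local Notation lm := (local_measurable F).
Local Notation mu := (trace_measure W).

Lemma matrix_measure_setD E G : lm E -> lm G -> G `<=` E ->
  W E = W G + W (E `\` G).
Proof.
move=> lmE lmG GE; apply/matrixP => i j; rewrite mxE; apply: scalar_ext; rewrite raddfD /=.
  exact: (local_additiveD (@sre_entry_additive _ _ _ _ _ _ _ W i j)).
exact: (local_additiveD (@sim_entry_additive _ _ _ _ _ _ _ W i j)).
Qed.

Lemma indicator_test (V : X -> 'M[K]_d) (E : set X) (v : 'cV[K]_d) :
  (forall x, psdmx (V x)) -> is_density W V -> (\forall x \ae mu, density W x = V x) ->
  lm E -> let f x := if x \in E then v else 0 in
  [/\ in_L2 W f, sqnorm_L2 W f = (rip (W E *m v) v)%:E &
    forall G, lm G -> G `<=` E -> mxm_integral W G f = W G *m v].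
Proof.
move=> V_psd VW V_ae lmE f; have mE := lm_measurable lmE.
have mf i : scalar_measurable (fun x => f x i 0).
  have mif (g : {additive K -> R}) : measurable_fun setT (fun x => g (f x i 0)).
    rewrite (_ : (fun x => _) = (fun x => if x \in E then g (v i 0) else 0)).
      apply: measurable_fun_ifT => //; apply: (measurable_fun_bool true).
      rewrite setTI (_ : _ @^-1` _ = E) //.
      by apply/seteqP; split=> x /=; [exact: set_mem|exact: mem_set].
    by apply/funext => x; rewrite /f; case: ifP => //; rewrite mxE raddf0.
  by split; [exact: (mif (@sre R k))|exact: (mif (@sim R k))].
have f_norm : sqnorm_L2 W f = (rip (W E *m v) v)%:E.
  rewrite (sqnorm_L2E VW V_ae mf); have [_ <-] := has_int_rip v v VW lmE.
  rewrite [RHS]integral_mkcond; apply: eq_integral => x _; rewrite /f patchE.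
  by case: ifP => //; rewrite mulmx0 rip0l.
have f_fin : (sqnorm_L2 W f < +oo)%E by rewrite f_norm ltry.
split=> // G lmG GE; apply: rip_ext => u.
apply: has_int_uniq (mxm_integral_has_int V_psd VW V_ae mf f_fin u lmG) _.
have [iG hG] := has_int_rip v u VW lmG.
have fE x : x \in G -> f x = v by rewrite inE /f => /GE /mem_set ->.
split.
  by apply: eq_integrable iG => // [|x xG /=]; [exact: lm_measurable lmG|rewrite fE].
by rewrite -hG; apply: eq_integral => x xG; rewrite fE.
Qed.

End matrix_measure_algebra.

(** * Testing and embedding constants *)

#[local] Existing Instance totally_filter.

(** * Unconditional sums of positive semidefinite matrices *)

Section nonnegative_nets.
Context {R : realType} {T : choiceType}.
Variables (D : set T) (g : T -> R).
Hypothesis g_ge0 : forall t, D t -> 0 <= g t.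

Let net (J : {fset T}) := \sum_(t <- J | t \in D) g t.

Lemma net_le (J J' : {fset T}) : (J `<=` J')%fset -> net J <= net J'.
Proof.
move=> JJ'; rewrite [leRHS]/net (bigID (mem J)) /=.
have -> : \sum_(t <- J' | (t \in D) && (t \in J)) g t = net J.
  rewrite /net -big_filter -[RHS]big_filter; apply: perm_big; apply: uniq_perm.
  - exact/filter_uniq/fset_uniq.
  - exact/filter_uniq/fset_uniq.
  move=> t; rewrite !mem_filter; case: (boolP (t \in J)) => [tJ|]; last by rewrite !andbF.
  by rewrite (fsubsetP JJ' _ tJ) !andbT.
by rewrite lerDl; apply: sumr_ge0 => t /andP[/set_mem Dt _]; exact: g_ge0.
Qed.

Lemma net_cvg B : (forall J, net J <= B) -> exists l : R, net @ totally --> l.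
Proof.
move=> netB; exists (sup (range net)).
have net_sup : has_sup (range net).
  by split; [exists (net fset0), fset0|exists B => _ [J _ <-]].
apply/cvgrPdist_lt => e e0.
have [_ [J0 _ <-] J0e] := sup_adherent e0 net_sup.
exists J0 => // J /= J0J.
have h1 : net J <= sup (range net) by apply: sup_upper_bound => //; exists J.
by rewrite ger0_norm ?subr_ge0 //; have := net_le J0J; lra.
Qed.

Lemma net_le_lim (l : R) J : net @ totally --> l -> net J <= l.
Proof.
move=> cv; rewrite -(cvg_lim (@Rhausdorff R) cv); apply: limr_ge.
  by apply/cvg_ex; exists l.
by exists J => // J' /= JJ'; exact: net_le.
Qed.

End nonnegative_nets.

Section matrix_sums.
Context {R : realType} {k : scalar_kind} {d : nat} {T : choiceType}.
Local Notation K := (base_field R k).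
Variables (D : set T) (u : T -> 'M[K]_d).

Lemma mxsum_rip S x y : mxsum_to D u S ->
  (fun J : {fset T} => \sum_(t <- J | t \in D) rip (u t *m x) y) @ totally --> rip (S *m x) y.
Proof.
move=> uS; rewrite rip_mulmxE.
have -> : (fun J : {fset T} => \sum_(t <- J | t \in D) rip (u t *m x) y) =
  (fun J => \sum_i \sum_j
    ((\sum_(t <- J | t \in D) sre (u t i j)) *
       (sre (x j 0) * sre (y i 0) + sim (x j 0) * sim (y i 0)) +
     (\sum_(t <- J | t \in D) sim (u t i j)) *
       (sre (x j 0) * sim (y i 0) - sim (x j 0) * sre (y i 0)))).
  apply/funext => J; rewrite (eq_bigr _ (fun t _ => rip_mulmxE (u t) x y)).
  rewrite exchange_big; apply: eq_bigr => i _; rewrite exchange_big; apply: eq_bigr => j _.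
  by rewrite big_split /= -!mulr_suml.
apply: cvg_big => [|i _]; first exact: add_continuous.
apply: cvg_big => [|j _]; first exact: add_continuous.
have [re_ij im_ij] := uS i j.
by apply: cvgD; apply: cvgMl.
Qed.

(** The partial sums of each quadratic form are monotone and bounded, hence converge; polarization
    then gives every <u x, y>, and in particular the real and imaginary parts of the entries. *)
Lemma mxsum_exists B : (forall t, D t -> psdmx (u t)) ->
  (forall J : {fset T}, forall x, \sum_(t <- J | t \in D) rip (u t *m x) x <= B x) ->
  exists S, mxsum_to D u S.
Proof.
move=> u0 uB.
have quad x : exists l : R, (fun J : {fset T} => \sum_(t <- J | t \in D) rip (u t *m x) x) @ totally --> l.
  apply: (net_cvg _ (fun J => uB J x)) => t /u0 /psdmxP[_]; exact.
have bil x y : exists l : R, (fun J : {fset T} => \sum_(t <- J | t \in D) rip (u t *m x) y) @ totally --> l.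
  have [[l1 c1] [l2 c2]] := (quad (x + y), quad (x - y)).
  exists ((l1 - l2) / 4).
  rewrite (_ : (fun J => _) = (fun J : {fset T} =>
    (\sum_(t <- J | t \in D) rip (u t *m (x + y)) (x + y) -
     \sum_(t <- J | t \in D) rip (u t *m (x - y)) (x - y)) / 4)).
    by apply: cvgMl; apply: cvgB.
  apply/funext => J; rewrite -sumrB mulr_suml; apply: eq_bigr => t /set_mem Dt.
  have /psdmxP[uu _] := u0 t Dt.
  rewrite mulmxBr mulmxDr !ripDl !ripDr !ripNl !ripNr.
  have -> : rip (u t *m y) x = rip (u t *m x) y by rewrite rip_adj uu ripC.
  by field.
have re_ex (ij : 'I_d * 'I_d) := bil (delta_mx ij.2 0) (delta_mx ij.1 0).
have im_ex (ij : 'I_d * 'I_d) := bil (delta_mx ij.2 0) (smk 0 1 *: delta_mx ij.1 0).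
have [p pP] := choice re_ex; have [q qP] := choice im_ex.
(* The factor is 1 over C and 0 over R, where imaginary parts are dropped. *)
have sim_smk (a b : R) : sim (smk a b : K) = sim (smk 0 1 : K) * b.
  by case: k => /=; rewrite ?mul0r ?mul1r.
exists (\matrix_(i, j) smk (p (i, j)) (q (i, j))) => i j; rewrite mxE sre_smk sim_smk; split.
  by under eq_fun do under eq_bigr do rewrite sre_rip_delta; exact: (pP (i, j)).
have -> : (fun J : {fset T} => \sum_(t <- J | t \in D) sim (u t i j)) =
  (fun J => sim (smk 0 1 : K) * \sum_(t <- J | t \in D) sim (u t i j)).
  apply/funext => J; rewrite mulr_sumr; apply: eq_bigr => t _.
  by rewrite -{1}(smk_eta (u t i j)) sim_smk.
apply: cvgMr.
by under eq_fun do under eq_bigr do rewrite sim_rip_delta; exact: (qP (i, j)).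
Qed.

Lemma mxsum_adj S : (forall t, D t -> psdmx (u t)) -> mxsum_to D u S -> adjmx S = S.
Proof.
move=> u0 uS; apply: eq_mx_mulcol => y; apply: rip_ext => x.
rewrite -[LHS]ripC -rip_adj ripC.
have c1 := mxsum_rip (x := x) (y := y) uS; have c2 := mxsum_rip (x := y) (y := x) uS.
have cE : (fun J : {fset T} => \sum_(t <- J | t \in D) rip (u t *m x) y) =
    (fun J : {fset T} => \sum_(t <- J | t \in D) rip (u t *m y) x).
  apply/funext => J; apply: eq_bigr => t /set_mem Dt.
  by have /psdmxP[uu _] := u0 t Dt; rewrite rip_adj uu ripC.
rewrite cE in c1; rewrite ripC.
by rewrite -(cvg_lim (@Rhausdorff R) c1) (cvg_lim (@Rhausdorff R) c2).
Qed.

Lemma mxsum_uniq S S' : mxsum_to D u S -> mxsum_to D u S' -> S = S'.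
Proof.
move=> uS uS'; apply/matrixP => i j; have [r i'] := uS i j; have [r' i''] := uS' i j.
apply: scalar_ext; first by rewrite -(cvg_lim (@Rhausdorff R) r) (cvg_lim (@Rhausdorff R) r').
by rewrite -(cvg_lim (@Rhausdorff R) i') (cvg_lim (@Rhausdorff R) i'').
Qed.

Lemma mxsum_quad_le S x (J : {fset T}) : (forall t, D t -> psdmx (u t)) -> mxsum_to D u S ->
  \sum_(t <- J | t \in D) rip (u t *m x) x <= rip (S *m x) x.
Proof.
move=> u0 uS; have u_ge0 t : D t -> 0 <= rip (u t *m x) x by move=> /u0 /psdmxP[_].
exact: (net_le_lim u_ge0 J (mxsum_rip (x := x) (y := x) uS)).
Qed.

Lemma mxsum_quad_lim S x B : mxsum_to D u S ->
  (forall J : {fset T}, \sum_(t <- J | t \in D) rip (u t *m x) x <= B) ->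
  rip (S *m x) x <= B.
Proof.
move=> uS uB; have c := mxsum_rip (x := x) (y := x) uS; rewrite -(cvg_lim (@Rhausdorff R) c).
by apply: limr_le; [apply/cvg_ex; exists (rip (S *m x) x)|exact: nearW].
Qed.

End matrix_sums.

(** Both Carleson conditions reduce to inequalities x <= a r with r >= 0, which pass to the infimum
    of the admissible a; the case r = 0 is kept apart from the division by r. *)
Lemma inf_least (R : realType) (P : R -> Prop) : (exists2 a, 0 <= a & P a) ->
  exists c, [/\ 0 <= c, forall a, 0 <= a -> P a -> c <= a,
    (forall b, c < b -> exists a, [/\ 0 <= a, P a & a < b]) &
    forall x r : R, 0 <= r -> (forall a, 0 <= a -> P a -> x <= a * r) -> x <= c * r].
Proof.
move=> [a0 a0_ge0 Pa0]; pose B := [set a | 0 <= a /\ P a].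
have B_lb : has_lbound B by exists 0 => a [].
have B_ne : B !=set0 by exists a0.
have inf_ltB b : inf B < b -> exists a, [/\ 0 <= a, P a & a < b].
  by move=> /(inf_lt B_ne)[a [a_ge0 Pa] ab]; exists a.
exists (inf B); split => //.
- by apply: lb_le_inf => // a [].
- by move=> a a_ge0 Pa; apply: ge_inf.
- move=> x r r0 xr; have [r_eq0|r_neq0] := eqVneq r 0.
    by have := xr _ a0_ge0 Pa0; rewrite r_eq0 !mulr0.
  rewrite -ler_pdivrMr ?lt0r ?r_neq0 //; apply: lb_le_inf => // a [a_ge0 Pa].
  by rewrite ler_pdivrMr ?lt0r ?r_neq0 //; exact: xr.
Qed.

(** * The two implications and the best constants *)

Section carleson_embedding_theorem.
Context {R : realType} {k : scalar_kind} {disp : measure_display}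
  {X : measurableType disp} {sigma : set X -> \bar R}
  {F : atomic_filtration sigma} {d : nat}.
Local Notation K := (base_field R k).
Local Notation lm := (local_measurable F).
Local Notation atom := (set X * int)%type.
Variables (W : matrix_measure k F d) (A : atom -> 'M[K]_d).
Hypothesis A_psd : forall I, atoms F I -> psdmx (A I).
Local Notation mu := (trace_measure W).
Local Notation below I0 := [set I | atoms F I /\ atom_sub I I0].

Let waw_psdW I : atoms F I -> psdmx (waw W A I).
Proof. exact: (waw_psd (@lm_atom _ _ _ _ F) (mxm_psd W) A_psd). Qed.

Let rip_wawW I u : atoms F I ->
  rip (waw W A I *m u) u = rip (A I *m (W I.1 *m u)) (W I.1 *m u).
Proof. exact: (rip_waw A (@lm_atom _ _ _ _ F) (mxm_psd W)). Qed.

Let W_adj I : atoms F I -> adjmx (W I.1) = W I.1.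
Proof. by move=> /lm_atom /(mxm_psd W) /psdmxP[]. Qed.

Let W_ge0 I u : atoms F I -> 0 <= rip (W I.1 *m u) u.
Proof. by move=> /lm_atom /(mxm_psd W) /psdmxP[]. Qed.

Lemma embedding_testing a : 0 <= a -> carleson_embedding W A a -> carleson_testing W A a.
Proof.
move=> a0 emb I0 FI0; have [V [V_psd VW V_ae]] := psd_density W.
have below_psd I : below I0 I -> psdmx (waw W A I) by move=> [/waw_psdW].
(* Atoms not below I_0 are discarded from the embedding sum; for the others the integral of the test
   function over I is W(I) u. *)
have bound (J : {fset atom}) u :
    \sum_(I <- J | I \in below I0) rip (waw W A I *m u) u <= a * rip (W I0.1 *m u) u.
  have [fL2 fnorm fint] := indicator_test u V_psd VW V_ae (lm_atom FI0).
  set f := (fun x => _) in fL2 fnorm fint.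
  have := emb f fL2; rewrite fnorm -EFinM => h; rewrite -lee_fin.
  apply: le_trans h; apply: esum_ge.
  pose J' := [seq I <- J | I \in below I0].
  exists [set` J'].
    split; first exact: finite_seq.
    by move=> I /=; rewrite mem_filter => /andP[/set_mem[]].
  rewrite -fsbig_seq ?filter_uniq ?fset_uniq // sumEFin lee_fin /J' big_filter.
  apply: ler_sum => I /set_mem[FI [II0 _]].
  by rewrite sqrtmx_norm ?fint ?rip_wawW //; [exact: lm_atom|exact: A_psd].
have [S SD] := mxsum_exists below_psd bound.
exists S => //; apply: loewner_leP.
- exact: mxsum_adj below_psd SD.
- by rewrite adjmxZ W_adj.
- move=> u; rewrite -scalemxAl ripZl; apply: mxsum_quad_lim SD _ => J; exact: bound.
Qed.

Lemma testing_mono b b' : b <= b' -> carleson_testing W A b -> carleson_testing W A b'.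
Proof.
move=> bb' tes I0 FI0; have [S SD SW] := tes I0 FI0; exists S => //.
apply: loewner_leP.
- by apply: mxsum_adj SD => I [/waw_psdW].
- by rewrite adjmxZ W_adj.
- move=> u; rewrite (le_trans (loewner_rip u SW)) // -!scalemxAl !ripZl.
  by rewrite ler_wpM2r // W_ge0.
Qed.

Lemma embedding_mono a a' : a <= a' -> carleson_embedding W A a -> carleson_embedding W A a'.
Proof.
have [V [V_psd VW V_ae]] := psd_density W.
move=> aa' emb f fL2; rewrite (le_trans (emb f fL2)) // lee_wpmul2r ?lee_fin //.
by apply: (sqnorm_L2_ge0 V_psd VW V_ae); have [] := fL2.
Qed.

(** Each finite set of atoms is handled by [finite_carleson] on the union of its members, with local
    sets as the class E and the energy of f as N. *)
Lemma testing_embedding b : 0 < b -> carleson_testing W A b ->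
  carleson_embedding W A (4 * d%:R ^+ 2 * b).
Proof.
move=> b0 tes f [mf f_fin]; have [V [V_psd VW V_ae]] := psd_density W.
have s0 := sqnorm_L2_ge0 V_psd VW V_ae mf.
apply: ge_ereal_sup => _ [B [finB BF] <-].
rewrite fsbig_finite //; set J := fset_set B.
have JB I : I \in J -> atoms F I by rewrite in_fset_set // => /set_mem /BF.
(* Empty atoms contribute zero and are removed, since the induction on the tree needs a point in
   each atom. *)
pose J' := [seq I <- J | I.1 != set0].
have -> : (\sum_(I <- J) (vnorm (sqrtmx (A I) *m mxm_integral W I.1 f) ^+ 2)%:E =
    (\sum_(I <- J') rip (A I *m mxm_integral W I.1 f) (mxm_integral W I.1 f))%:E)%E.
  rewrite sumEFin; congr EFin.
  rewrite /J' big_filter [RHS]big_mkcond big_seq [RHS]big_seq; apply: eq_bigr => I /JB FI.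
  rewrite sqrtmx_norm; last exact: A_psd.
  case: eqVneq => // I0.
  suff -> : mxm_integral W I.1 f = 0 by rewrite mulmx0 rip0l.
  apply/colP => i; rewrite !mxE I0 /scalar_integral !integral_set0.
  by apply: scalar_ext; rewrite ?sre_smk ?raddf0 //; case: k.
pose G := \big[setU/set0]_(I <- J') I.1.
have J'F I : I \in J' -> atoms F I by rewrite mem_filter => /andP[_ /JB].
have lmG : lm G by exact: lm_bigsetU.
have key := @finite_carleson _ _ _ _ _ F d lm W (fun E => mxm_integral W E f)
  (energy_on W V f) A (@lm_atom _ _ _ _ F) (@lm_setD _ _ _ _ F) (mxm_psd W) A_psd
  (@matrix_measure_setD _ _ _ _ _ _ _ W) (mxm_integral_setD V_psd VW V_ae mf f_fin)
  (energy_on_setD V_psd VW V_ae mf f_fin)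
  (fun E u => @energy_ineq _ _ _ _ _ _ _ _ _ V_psd VW V_ae _ mf f_fin E u) b J' G b0.
apply: (@le_trans _ _ ((4 * d%:R ^+ 2 * b) * energy_on W V f G)%:E).
  rewrite lee_fin; apply: key => //.
  - by rewrite filter_uniq // fset_uniq.
  - move=> I IJ; split; first exact: J'F.
      by move: IJ; rewrite mem_filter => /andP[/set0P].
    by rewrite /G => x Ix; rewrite -bigcup_seq; exists I.
  - move=> I IJ; have FI := J'F I IJ; have [S SD SW] := tes I FI.
    have below_psd I' : below I I' -> psdmx (waw W A I') by move=> [/waw_psdW].
    apply: loewner_leP.
    + rewrite /subtree adjmx_sum big_seq_cond [RHS]big_seq_cond.
      by apply: eq_bigr => I' /andP[/J'F /waw_psdW /psdmxP[]].
    + by rewrite adjmxZ W_adj.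
    + move=> u; apply: le_trans (loewner_rip u SW).
      (* The subtree is a finite partial sum of a series of positive matrices with sum S, hence at
         most S. *)
      apply: le_trans (mxsum_quad_le u [fset I' in J']%fset below_psd SD).
      rewrite /subtree mulmx_suml rip_suml -big_filter -[leRHS]big_filter.
      rewrite le_eqVlt; apply/orP; left; apply/eqP; apply: perm_big; apply: uniq_perm.
      * by rewrite !filter_uniq // fset_uniq.
      * by rewrite filter_uniq // fset_uniq.
      have J'E I' : (I' \in [fset I' in J']%fset) = (I' \in J') by rewrite !inE.
      move=> I'; rewrite mem_filter [RHS]mem_filter J'E; apply/andP/andP => -[h I'J].
        by split=> //; apply/mem_set; split; [exact: J'F|exact/asboolP].
      by split=> //; move: h => /set_mem[_ I'I]; apply/asboolP.
rewrite EFinM; apply: lee_wpmul2l; last exact: (energy_on_le V_psd VW V_ae mf f_fin).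
by rewrite lee_fin !mulr_ge0 ?sqr_ge0 // ltW.
Qed.

Lemma testing_embedding_ge0 b : carleson_testing W A b -> exists2 a, 0 <= a & carleson_embedding W A a.
Proof.
move=> tes; have b1 : 0 < `|b| + 1 by rewrite ltr_pwDr.
exists (4 * d%:R ^+ 2 * (`|b| + 1)); first by rewrite !mulr_ge0 ?sqr_ge0 // ltW.
apply: testing_embedding => //; apply: testing_mono tes.
by rewrite (le_trans (ler_norm _)) // lerDl.
Qed.

(** For a fixed f and a fixed finite set of atoms the inequality is linear in the constant and
    survives the infimum; the supremum over finite sets is taken afterwards. *)
Lemma best_embedding_constant : (exists2 a, 0 <= a & carleson_embedding W A a) ->
  exists a, best_constant (carleson_embedding W A) a.
Proof.
move=> /inf_least[a [a0 a_least _ a_inf]]; exists a; split=> // f [mf f_fin].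
have [V [V_psd VW V_ae]] := psd_density W.
have s0 := sqnorm_L2_ge0 V_psd VW V_ae mf.
have s_fin : sqnorm_L2 W f \is a fin_num by rewrite ge0_fin_numE.
apply: ge_ereal_sup => _ [B finB <-].
have sum_fin : (\sum_(I \in B) (vnorm (sqrtmx (A I) *m mxm_integral W I.1 f) ^+ 2)%:E)%E =
    (\sum_(I <- fset_set B) vnorm (sqrtmx (A I) *m mxm_integral W I.1 f) ^+ 2)%:E.
  by rewrite fsbig_finite; [rewrite sumEFin|case: finB].
rewrite sum_fin -(fineK s_fin) -EFinM lee_fin; apply: a_inf.
  by rewrite fine_ge0.
move=> a' _ /(_ f (conj mf f_fin)) emb.
rewrite -lee_fin EFinM fineK // (le_trans _ emb) //.
by apply: esum_ge; exists B => //; rewrite sum_fin.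
Qed.

(** By uniqueness of limits S is the same for all constants, so the infimum is taken in the
    quadratic form of one S. The constants above the best one are recorded because the best one may
    be 0, whereas [testing_embedding] takes a positive constant. *)
Lemma best_testing_constant : (exists2 b, 0 <= b & carleson_testing W A b) ->
  exists2 b, best_constant (carleson_testing W A) b &
    forall b', b < b' -> carleson_testing W A b'.
Proof.
move=> tes; have [b1 b1_ge0 tes1] := tes.
have [b [b0 b_least b_approx b_inf]] := inf_least tes; exists b.
  split=> // I0 FI0; have [S SD SW] := tes1 I0 FI0; exists S => //.
  apply: loewner_leP.
  - by apply: mxsum_adj SD => I [/waw_psdW].
  - by rewrite adjmxZ W_adj.
  - move=> u; rewrite -scalemxAl ripZl; apply: b_inf; first exact: W_ge0.
    move=> b' _ /(_ I0 FI0)[S' S'D S'W].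
    by rewrite (mxsum_uniq SD S'D) (le_trans (loewner_rip u S'W)) // -scalemxAl ripZl.
move=> b' /b_approx[b2 [b2_ge0 tes2 b2b']].
by apply: testing_mono tes2; exact: ltW.
Qed.

End carleson_embedding_theorem.

Theorem theorem1p1 (R : realType) (k : scalar_kind)
    (disp : measure_display) (X : measurableType disp)
    (sigma : {sigma_finite_measure set X -> \bar R})
    (F : atomic_filtration sigma) (d : nat) (W : matrix_measure k F d)
    (A : set X * int -> 'M[base_field R k]_d)
    (psdA : forall I, atoms F I -> psdmx (A I)) :
  ((exists a : R, carleson_embedding W A a) <->
   (exists b : R, carleson_testing W A b)) /\
  ((exists a : R, carleson_embedding W A a) ->
   exists a b : R,
     [/\ best_constant (carleson_embedding W A) a,
         best_constant (carleson_testing W A) b,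
         b <= a &
         a <= 4 * expR 1 ^+ 2 * d%:R ^+ 2 * b]).
Proof.
have emb_ge0 : (exists a, carleson_embedding W A a) ->
    exists2 a, 0 <= a & carleson_embedding W A a.
  by move=> [a emb]; exists `|a|; rewrite ?normr_ge0 //; apply: embedding_mono emb; exact: ler_norm.
split; first split.
- by move=> /emb_ge0[a a0 emb]; exists a; exact: embedding_testing.
- by move=> [b /(testing_embedding_ge0 psdA)[a _ emb]]; exists a.
move=> /emb_ge0 emb; have [a0 a0_ge0 emb0] := emb.
have [a a_best] := best_embedding_constant emb.
have [b b_best tes_gt] := best_testing_constant psdA
  (ex_intro2 _ _ a0 a0_ge0 (embedding_testing psdA a0_ge0 emb0)).
have [a_ge0 emb_a a_least] := a_best; have [b_ge0 tes_b b_least] := b_best.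
exists a, b; split=> //; first by apply: b_least => //; exact: embedding_testing.
have ab : a <= 4 * d%:R ^+ 2 * b.
  have C0 : 0 <= 4 * d%:R ^+ 2 :> R by rewrite mulr_ge0 ?sqr_ge0.
  apply/ler_addgt0Pr => e e0.
  (* The summand 1 keeps the denominator positive when d = 0 and still gives 4 d^2 (b' - b) <= e. *)
  pose b' := b + e / (4 * d%:R ^+ 2 + 1).
  have bb' : b < b' by rewrite ltrDl divr_gt0 // ltr_wpDl.
  have b'0 : 0 < b' by exact: le_lt_trans bb'.
  apply: (@le_trans _ _ (4 * d%:R ^+ 2 * b')).
    apply: a_least; first by rewrite mulr_ge0 // ltW.
    exact: testing_embedding (tes_gt _ bb').
  rewrite mulrDr lerD2l mulrCA ler_piMr ?(ltW e0) //.
  by rewrite ler_pdivrMr ?mul1r ?lerDl // ltr_wpDl.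
(* The bound with 4 d^2 implies the stated one since e >= 1. *)
have e1 : 1 <= expR 1 :> R by rewrite -[leLHS]expR0 ler_expR.
apply: (le_trans ab); rewrite [leRHS](_ : _ = expR 1 ^+ 2 * (4 * d%:R ^+ 2 * b)); last by ring.
by apply: ler_peMl; [rewrite !mulr_ge0 ?sqr_ge0|exact: exprn_ege1].
Qed.
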